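(* Let $H$ be an ordered graph on $h$ vertices. Then $c_<(H)=1-\frac{1}{\chi^*_{cr}(H)}$.
   Context: An ordered graph on $h$ vertices is a graph with vertex set $[h]$ (ordered naturally). An ordered graph $G$ on $[n]$ contains an ordered graph $H$ on $[h]$ if there is an injection $\phi:[h]\to[n]$ with $\phi(i)<\phi(j)$ for $i<j$ and $\phi(i)\phi(j)\in E(G)$ whenever $ij\in E(H)$; the image is a copy of $H$. An $H$-tiling is a collection of vertex-disjoint copies of $H$; perfect if it covers all vertices. $c_<(H)$ denotes the smallest non-negative number $c$ such that for every $\eta>0$ there exists $n_0$ so that every ordered graph $G$ on $n\ge n_0$ vertices with $\delta(G)\ge cn$ contains an $H$-tiling covering all but at most $\eta n$ vertices. For sets of integers, $X<Y$ means $a<b$ for all $a\in X,b\in Y$. For a complete $k$-partite unordered graph $B$ with parts $U_1,\dots,U_k$ and a permutation $\sigma$ of $[k]$, an interval labelling w.r.t. $\sigma$ is a bijection $\phi:V(B)\to[|B|]$ with $\phi(U_i)<\phi(U_j)$ when $\sigma(i)<\sigma(j)$; the ordered blow-up $(B(t),\phi)$ replaces each vertex $x$ by $t$ independent vertices $V_x$ (complete bipartite between $V_x,V_y$ when $xy\in E(B)$) ordered so that $V_x<V_y$ when $\phi(x)<\phi(y)$. $B$ is a bottlegraph of $H$ if for every such $\sigma,\phi$ there is $t$ with $(B(t),\phi)$ containing a perfect $H$-tiling. $\chi_{cr}(F)=(\chi(F)-1)|F|/(|F|-\sigma(F))$ for unordered $F$, with $\sigma(F)$ the least size of a colour class over proper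 $\chi(F)$-colourings; $\chi^*_{cr}(H)=\inf\{\chi_{cr}(B): B \text{ a bottlegraph of } H\}$. *)

(* Defs.v *)
From HB Require Import structures.
From mathcomp Require Import all_boot all_order all_fingroup all_algebra.
From mathcomp Require Import classical_sets reals.

Set Implicit Arguments.
Unset Strict Implicit.
Unset Printing Implicit Defensive.

Import Order.TTheory GRing.Theory Num.Theory.
Local Open Scope ring_scope.

Record sgraph (V : finType) := SGraph {
  adj :> rel V;
  adj_sym : symmetric adj;
  adj_irr : irreflexive adj }.

(* The vertices of an ordered graph are 0, ..., n - 1 instead of 1, ..., n. *)
Definition ordered_graph (n : nat) := sgraph 'I_n.

Definition degree (V : finType) (G : sgraph V) (x : V) : nat :=
  #|[set y | G x y]%SET|.

(* The default value #|V| exceeds every degree, so it only matters when V is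
   empty. *)
Definition mindegree (V : finType) (G : sgraph V) : nat :=
  \big[minn/#|V|]_(x : V) degree G x.

(** * Chromatic and critical chromatic numbers *)

Definition proper_colouring (V : finType) (G : sgraph V) (k : nat)
    (c : {ffun V -> 'I_k}) : bool :=
  [forall x, forall y, G x y ==> (c x != c y)].

Definition colourable (V : finType) (G : sgraph V) (k : nat) : bool :=
  [exists c : {ffun V -> 'I_k}, proper_colouring G c].

Lemma colourable_ex (V : finType) (G : sgraph V) : exists k, colourable G k.
Proof.
exists #|V|; apply/existsP; exists [ffun x => enum_rank x].
apply/forallP => x; apply/forallP => y; apply/implyP => Gxy.
rewrite !ffunE; apply: contraTneq Gxy => /enum_rank_inj ->.
by rewrite adj_irr.
Qed.

Definition chi (V : finType) (G : sgraph V) : nat := ex_minn (colourable_ex G).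

(* The default value #|V| bounds the size of every colour class, so it does not
   affect the minimum as soon as V is nonempty. *)
Definition sigma (V : finType) (G : sgraph V) : nat :=
  \big[minn/#|V|]_(c : {ffun V -> 'I_(chi G)} | proper_colouring G c)
    \big[minn/#|V|]_(i < chi G) #|[set x | c x == i]%SET|.

Definition chi_cr (R : realType) (V : finType) (G : sgraph V) : R :=
  ((chi G)%:R - 1) * #|V|%:R / (#|V|%:R - (sigma G)%:R).

(** * Tilings of ordered graphs *)

Definition is_embedding (h n : nat) (H : ordered_graph h) (G : ordered_graph n)
    (f : 'I_h -> 'I_n) : Prop :=
  [/\ injective f,
      forall i j : 'I_h, (i < j)%N -> (f i < f j)%N
    & forall i j : 'I_h, H i j -> G (f i) (f j)].

(* An increasing map is determined by its image, so copies of H and embeddings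
   of H are in bijection. *)
Definition is_tiling (h n : nat) (H : ordered_graph h) (G : ordered_graph n)
    (T : {set {ffun 'I_h -> 'I_n}}) : Prop :=
  (forall f, f \in T -> is_embedding H G f) /\
  (forall f g, f \in T -> g \in T -> f != g -> [disjoint codom f & codom g]).

Definition covered (h n : nat) (T : {set {ffun 'I_h -> 'I_n}}) : {set 'I_n} :=
  (\bigcup_(f in T) [set x in codom f])%SET.

Definition has_perfect_tiling (h n : nat) (H : ordered_graph h)
    (G : ordered_graph n) : Prop :=
  exists T, is_tiling H G T /\ forall x, x \in covered T.

(** * The threshold for almost perfect tilings *)

Definition forces_almost_tiling (R : realType) (h : nat) (H : ordered_graph h)
    (c : R) : Prop :=
  forall eta : R, 0 < eta -> exists n0 : nat,
    forall (n : nat) (G : ordered_graph n), (n0 <= n)%N ->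
      c * n%:R <= (mindegree G)%:R ->
      exists T, is_tiling H G T /\ #|~: covered T|%:R <= eta * n%:R.

(* c_<(H) = c *)
Definition is_c_lt (R : realType) (h : nat) (H : ordered_graph h) (c : R)
    : Prop :=
  [/\ 0 <= c, forces_almost_tiling H c
    & forall c' : R, 0 <= c' -> forces_almost_tiling H c' -> c <= c'].

(** * Bottlegraphs *)

(* U x is the index of the part that contains x. *)
Definition complete_partite (V : finType) (k : nat) (B : sgraph V)
    (U : V -> 'I_k) : Prop :=
  (forall i, exists x, U x = i) /\ (forall x y, B x y = (U x != U y)).

Definition interval_labelling (b k : nat) (U : 'I_b -> 'I_k) (s : 'S_k)
    (phi : 'S_b) : Prop :=
  forall x y : 'I_b, (s (U x) < s (U y))%N -> (phi x < phi y)%N.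

Lemma block_subproof (b t : nat) (m : 'I_(b * t)) : (m %/ t < b)%N.
Proof.
case: t m => [|t] m; last by rewrite ltn_divLR.
by case: m => m; rewrite muln0.
Qed.

Definition block (b t : nat) (m : 'I_(b * t)) : 'I_b :=
  Ordinal (block_subproof m).

(* V_x consists of the t consecutive integers m with m %/ t = phi x. *)
Definition blowup_adj (b : nat) (B : sgraph 'I_b) (phi : 'S_b) (t : nat)
    : rel 'I_(b * t) := fun m m' =>
  B ((phi^-1)%g (block m)) ((phi^-1)%g (block m')).

Lemma blowup_sym (b : nat) (B : sgraph 'I_b) (phi : 'S_b) (t : nat) :
  symmetric (@blowup_adj b B phi t).
Proof. by move=> m m'; rewrite /blowup_adj adj_sym. Qed.

Lemma blowup_irr (b : nat) (B : sgraph 'I_b) (phi : 'S_b) (t : nat) :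
  irreflexive (@blowup_adj b B phi t).
Proof. by move=> m; rewrite /blowup_adj adj_irr. Qed.

Definition blowup (b : nat) (B : sgraph 'I_b) (phi : 'S_b) (t : nat)
    : ordered_graph (b * t) :=
  SGraph (@blowup_sym b B phi t) (@blowup_irr b B phi t).

(* Without 0 < t the empty graph would be an admissible blow-up. *)
Definition is_bottlegraph (h : nat) (H : ordered_graph h) (b : nat)
    (B : sgraph 'I_b) : Prop :=
  exists (k : nat) (U : 'I_b -> 'I_k), complete_partite B U /\
    forall (s : 'S_k) (phi : 'S_b), interval_labelling U s phi ->
      exists t : nat, (0 < t)%N /\ has_perfect_tiling H (blowup B phi t).

(* The formula for chi_cr B reads 0 / 0 when B has a single part, which can only
   be a bottlegraph of an edgeless H; the infimum ranges over the bottlegraphs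
   for which chi_cr is defined. *)
Definition chi_cr_star (R : realType) (h : nat) (H : ordered_graph h) : R :=
  inf [set r : R | exists (b : nat) (B : sgraph 'I_b),
    [/\ is_bottlegraph H B, (1 < chi B)%N & r = chi_cr R B]]%classic.

(* Main.v *)
(**
  Lower bound on c_<(H).  If c < 1 forces almost perfect H-tilings, take the
  complete multipartite graph B with parts of size m, ..., m, s on b vertices,
  where m / b is at most, and close to, 1 - c.  All ordered blow-ups of B then
  have almost perfect H-tilings.  Whether some blow-up of a labelled B has a
  perfect H-tiling is a linear programming question, so by Farkas' lemma almost
  perfect tilings of arbitrarily large blow-ups give a perfect one.  Hence B is
  a bottlegraph, and chi_cr(B) <= b / m.

  Upper bound.  Let B be a bottlegraph.  Averaging over the orders of its parts,
  we may replace it by part sizes m, ..., m, s with s < m and about the same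
  critical chromatic number (r m + s) / m.  Cut the vertex set of G into many
  intervals and delete the edges inside them, so that the parts of a complete
  multipartite subgraph are ordered as soon as each lies in one interval.  It is
  then enough to tile G almost perfectly with tiles, which are such subgraphs
  with part sizes t m, ..., t m, t s.  This is Komlos' theorem, and it is proved
  without the regularity lemma.  Suppose that the uncovered set W is large.
  Either W is dense and contains a tile by Erdos-Stone, or some tile Q of a much
  larger scale sees W densely; by pigeonhole many vertices of W have the same
  neighbourhood in Q, which meets all large parts of Q, and Q can be retiled at
  the smaller scale together with some of these vertices.  Repeating this gains
  a proportion of n that does not depend on the scale.

  The minimum degree needed is slightly above (1 - 1 / chi*_cr(H)) n; adding few
  dominating vertices to G removes this loss.
*)

Require Import Defs.
From mathcomp Require Import classical_sets reals.
From mathcomp Require Import all_boot all_order all_fingroup all_algebra.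
From mathcomp Require Import zify ring lra.

Set Implicit Arguments.
Unset Strict Implicit.
Unset Printing Implicit Defensive.

Import Order.TTheory GRing.Theory Num.Theory.
Local Open Scope ring_scope.

(** * Cardinalities of finite sets and the pigeonhole principle *)

Lemma exists_natr_gt (R : archiRealFieldType) (x : R) : exists N : nat, x < N%:R.
Proof.
exists (Num.bound `|x|); apply: le_lt_trans (ler_norm x) _.
exact: archi_boundP.
Qed.

Lemma subset_of_card (V : finType) (A : {set V}) (n : nat) :
  (n <= #|A|)%N -> exists B : {set V}, B \subset A /\ #|B| = n.
Proof.
move=> nA; exists [set x in take n (enum A)]; split.
  by apply/subsetP => x; rewrite inE => /mem_take; rewrite mem_enum.
rewrite cardsE (card_uniqP _) ?take_uniq ?enum_uniq //.
by rewrite size_takel // -cardE.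
Qed.

Lemma cardsU_disjoint (V : finType) (A B : {set V}) :
  [disjoint A & B] -> #|A :|: B| = (#|A| + #|B|)%N.
Proof. by rewrite -setI_eq0 -cardsUI => /eqP ->; rewrite cards0 addn0. Qed.

Lemma leq_cardI (V : finType) (N B Q : {set V}) :
  N \subset Q -> B \subset Q -> (#|N| + #|B| <= #|N :&: B| + #|Q|)%N.
Proof.
move=> NQ BQ; rewrite -cardsUI addnC leq_add2l subset_leq_card //.
by rewrite subUset NQ.
Qed.

Lemma pigeonhole (V T : finType) (f : V -> T) (S : {set V}) (P : {set T})
    (K : nat) :
  (forall x, x \in S -> f x \in P) -> (#|P| * K < #|S|)%N ->
  exists y, (K < #|[set x in S | f x == y]|)%N.
Proof.
move=> fP ltPS; apply/existsP; move: ltPS; apply: contraTT.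
rewrite negb_exists -leqNgt => /forallP fib.
rewrite -sum1_card (partition_big f (mem P)) //= -sum_nat_const.
apply: leq_sum => y _; rewrite sum1dep_card.
by move: (fib y); rewrite -leqNgt.
Qed.

(** * Vectors of part sizes that guarantee a tiling *)

Section Tileable.

Variables (V I : finType) (fam : (I -> {set V}) -> Prop) (good : {set V} -> Prop).

(** [fam] will stand for cliques, ordered cliques, or sets lying in the blocks of a blow-up, and
    [good] for the sets that a tiling covers exactly. The lemmas below then reduce the building of
    tilings to arithmetic with size vectors. *)
Definition tileable (u : I -> nat) : Prop :=
  forall A, fam A -> (forall i, #|A i| = u i) -> good (\bigcup_i A i).

Hypothesis fam_sub : forall A A' : I -> {set V},
  (forall i, A' i \subset A i) -> fam A -> fam A'.
Hypothesis fam_disj : forall A i j, fam A -> i != j -> [disjoint A i & A j].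
Hypothesis good0 : good set0.
Hypothesis goodU : forall X Y : {set V},
  good X -> good Y -> [disjoint X & Y] -> good (X :|: Y).

Lemma eq_tileable (u v : I -> nat) : u =1 v -> tileable u -> tileable v.
Proof. by move=> uv tu A fA sA; apply: tu => // i; rewrite sA uv. Qed.

Lemma tileable0 : tileable (fun=> 0%N).
Proof.
move=> A _ sA; rewrite big1 // => i _.
by apply/eqP; rewrite -cards_eq0 sA.
Qed.

(** Each part is cut into pieces of sizes [u i] and [v i]; the two families of pieces are tiled
    separately. *)
Lemma tileableD (u v : I -> nat) :
  tileable u -> tileable v -> tileable (fun i => u i + v i)%N.
Proof.
move=> tu tv A fA sA.
have /fin_all_exists [A' A'P] : forall i, exists B : {set V},
    B \subset A i /\ #|B| = u i.
  by move=> i; apply: subset_of_card; rewrite sA leq_addr.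
pose A'' i := A i :\: A' i.
have -> : \bigcup_i A i = (\bigcup_i A' i) :|: (\bigcup_i A'' i).
  rewrite -big_split /=; apply: eq_bigr => i _.
  by rewrite /A'' setDE setUIr setUCr setIT; apply/esym/setUidPr; case: (A'P i).
apply: goodU.
- apply: tu; last by move=> i; case: (A'P i).
  by apply: fam_sub fA => i; case: (A'P i).
- apply: tv; first by apply: fam_sub fA => i; apply: subsetDl.
  move=> i; case: (A'P i) => sub cA'.
  by rewrite /A'' cardsD (setIidPr sub) cA' sA addKn.
- rewrite -setI_eq0; apply/eqP/setP => x; rewrite !inE.
  apply/negP => /andP[/bigcupP[i _ xi] /bigcupP[j _]].
  rewrite !inE => /andP[xj' xj].
  have [eij|nij] := eqVneq i j; first by rewrite -eij xi in xj'.
  have /subsetP/(_ x xi) xAi := (A'P i).1.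
  by have := fam_disj fA nij; rewrite disjoints_subset => /subsetP/(_ x xAi); rewrite inE xj.
Qed.

Lemma tileable_sum (J : finType) (P : pred J) (u : J -> I -> nat) :
  (forall j, P j -> tileable (u j)) ->
  tileable (fun i => \sum_(j | P j) u j i)%N.
Proof.
move=> tu; have : forall s : seq J, tileable (fun i => \sum_(j <- s | P j) u j i)%N.
  elim=> [|j s IHs].
    by apply: eq_tileable tileable0 => i; rewrite big_nil.
  have [Pj|nPj] := boolP (P j).
    by apply: eq_tileable (tileableD (tu j Pj) IHs) => i; rewrite big_cons Pj.
  by apply: eq_tileable IHs => i; rewrite big_cons (negbTE nPj).
by apply.
Qed.

Lemma tileableM (n : nat) (u : I -> nat) :
  tileable u -> tileable (fun i => n * u i)%N.
Proof.
move=> tu; elim: n => [|n IHn]; first by apply: eq_tileable tileable0.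
by apply: eq_tileable (tileableD tu IHn) => i; rewrite mulSn.
Qed.

End Tileable.

(** * Komlos' tiling theorem *)

Section Cliques.

Variables (V : finType) (G : sgraph V) (M : nat) (lab : V -> 'I_M).
Implicit Types (A B N Q S W X Y : {set V}).

Definition nbhd (x : V) : {set V} := [set y | G x y].

Definition joined A B : Prop := forall x y, x \in A -> y \in B -> G x y.

Definition monolabel A : Prop := {in A &, forall x y, lab x = lab y}.

(** The [A i] are the parts of a complete multipartite subgraph, not necessarily induced. Labels
    will name the intervals into which the vertex set is cut. *)
Definition clique (I : finType) (A : I -> {set V}) : Prop :=
  (forall i, monolabel (A i)) /\ (forall i j, i != j -> joined (A i) (A j)).

Lemma clique_sub (I : finType) (A A' : I -> {set V}) :
  (forall i, A' i \subset A i) -> clique A -> clique A'.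
Proof.
move=> sub [mA jA]; split=> [i x y xi yi|i j nij x y xi yj].
  by apply: (mA i); apply: (subsetP (sub i)).
by apply: (jA i j) => //; [apply: (subsetP (sub i))|apply: (subsetP (sub j))].
Qed.

Lemma joined_disjoint A B : joined A B -> [disjoint A & B].
Proof.
move=> jAB; rewrite disjoints_subset; apply/subsetP => x xA; rewrite inE.
by apply/negP => xB; have := jAB x x xA xB; rewrite adj_irr.
Qed.

Lemma clique_disjoint (I : finType) (A : I -> {set V}) i j :
  clique A -> i != j -> [disjoint A i & A j].
Proof. by move=> [_ jA] /jA/joined_disjoint. Qed.

Lemma card_clique (I : finType) (A : I -> {set V}) :
  clique A -> #|\bigcup_i A i| = (\sum_i #|A i|)%N.
Proof.
move=> cA; rewrite -sum1_card partition_disjoint_bigcup; last first.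
  by move=> i j; apply: clique_disjoint cA.
by apply: eq_bigr => i _; rewrite sum1_card.
Qed.

Lemma card_nbhdI (x : V) Q : #|nbhd x :&: Q| = (\sum_(y in Q) G x y)%N.
Proof.
rewrite -sum1_card big_mkcond [RHS]big_mkcond; apply: eq_bigr => y _.
by rewrite !inE andbC; case: (y \in Q) => //=; case: (G x y).
Qed.

Lemma sum_card_nbhdI W Q :
  (\sum_(w in W) #|nbhd w :&: Q| = \sum_(x in Q) #|nbhd x :&: W|)%N.
Proof.
under eq_bigr do rewrite card_nbhdI.
rewrite exchange_big; apply: eq_bigr => x _; rewrite card_nbhdI.
by apply: eq_bigr => w _; rewrite adj_sym.
Qed.

(** By averaging, at least [eps * #|W|] vertices of [W] have [(d + eps) * #|Q|] neighbours in [Q].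
    Pairs of a neighbourhood in [Q] and a label number at most [2 ^ #|Q| * M], so [K] of these
    vertices share both. *)
Lemma common_nbhd (R : realType) (d eps : R) Q W (K : nat) :
  0 < eps -> eps <= 1 -> 0 <= d ->
  (d + 2 * eps) * #|W|%:R * #|Q|%:R <= (\sum_(w in W) #|nbhd w :&: Q|)%:R ->
  (2 ^ #|Q| * M * K)%:R < eps * #|W|%:R ->
  exists N W', [/\ N \subset Q, W' \subset W, #|W'| = K &
    [/\ monolabel W', joined W' N & (d + eps) * #|Q|%:R <= #|N|%:R]].
Proof.
move=> e0 e1 d0 sumWQ ltK.
pose S := [set w in W | (d + eps) * #|Q|%:R <= #|nbhd w :&: Q|%:R].
have SW : S \subset W by apply/subsetP => x; rewrite inE => /andP[].
have leS : eps * #|W|%:R <= #|S|%:R.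
  have [Q0|Qpos] := posnP #|Q|.
    have -> : S = W by apply/setP => x; rewrite inE Q0 mulr0 ler0n andbT.
    by rewrite -[leRHS]mul1r ler_wpM2r.
  have Qgt : 0 < #|Q|%:R :> R by rewrite ltr0n.
  rewrite -(ler_pM2r Qgt).
  have : (\sum_(w in W) #|nbhd w :&: Q|)%:R <=
      #|S|%:R * #|Q|%:R + #|W|%:R * ((d + eps) * #|Q|%:R) :> R.
    rewrite (big_setID S) /= (setIidPr SW) natrD !natr_sum lerD //.
      rewrite mulr_natl -sumr_const; apply: ler_sum => x _.
      by rewrite ler_nat subset_leq_card // subsetIr.
    apply: (@le_trans _ _ (#|W :\: S|%:R * ((d + eps) * #|Q|%:R))).
      rewrite [leRHS]mulr_natl -sumr_const; apply: ler_sum => x.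
      by rewrite !inE => /andP[+ xW]; rewrite xW /= -ltNge => /ltW.
    apply: ler_wpM2r; first by rewrite mulr_ge0 ?addr_ge0 // ltW.
    by rewrite ler_nat subset_leq_card // subsetDl.
  lra.
pose f w := (nbhd w :&: Q, lab w).
have [||y ltf] := @pigeonhole _ _ f S (setX (powerset Q) setT) K.
- by move=> x _; rewrite !inE subsetIr.
- rewrite cardsX card_powerset cardsT card_ord.
  by rewrite -(ltr_nat R) (lt_le_trans ltK).
have [w0 w0F] : exists w0, w0 \in [set x in S | f x == y].
  by apply/set0Pn; rewrite -card_gt0; apply: leq_ltn_trans ltf.
have [W' [W'F cW']] := subset_of_card (ltnW ltf).
have inF x : x \in W' -> [/\ x \in S, nbhd x :&: Q = y.1 & lab x = y.2].
  by move=> /(subsetP W'F); rewrite inE => /andP[xS /eqP <-].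
move: w0F; rewrite inE => /andP[w0S /eqP ew0].
exists y.1, W'; split=> //; first by rewrite -ew0 subsetIr.
- by apply/subsetP => x /inF[xS _ _]; apply: (subsetP SW).
- split.
  + by move=> x z /inF[_ _ ->] /inF[_ _ ->].
  + by move=> x z /inF[_ <- _]; rewrite !inE => /andP[].
  + by move: w0S; rewrite inE -ew0 => /andP[].
Qed.

(** [S] maximises the degree sum minus [(d + eps) * #|S| ^ 2]. Comparing it with [W] bounds its size
    from below; comparing it with [S :\ x] bounds the degree of [x]. *)
Lemma dense_subset (R : realType) (d eps : R) W :
  0 < eps -> 0 <= d ->
  (d + 2 * eps) * #|W|%:R ^+ 2 <= (\sum_(w in W) #|nbhd w :&: W|)%:R ->
  exists S, [/\ S \subset W, eps * #|W|%:R ^+ 2 <= #|S|%:R ^+ 2 &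
    forall x, x \in S -> (d + eps) * #|S|%:R - (d + eps) <= #|nbhd x :&: S|%:R].
Proof.
move=> e0 d0 dW.
pose D S := (\sum_(w in S) #|nbhd w :&: S|)%N.
pose f S : R := (D S)%:R - (d + eps) * #|S|%:R ^+ 2.
pose S := [arg max_(S > W | S \subset W) f S]%O.
have [SW Smax] : S \subset W /\ forall S', S' \subset W -> f S' <= f S.
  by rewrite /S; case: Order.TotalTheory.arg_maxP => // S' ? ?; split.
exists S; split=> //.
  have DS : (D S)%:R <= #|S|%:R ^+ 2 :> R.
    rewrite -natrX ler_nat expnS expn1 -sum_nat_const; apply: leq_sum => x _.
    by rewrite subset_leq_card // subsetIr.
  have := Smax W (subxx _); rewrite /f.
  have -> : (D W)%:R = (\sum_(w in W) #|nbhd w :&: W|)%:R :> R by [].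
  have dS : 0 <= (d + eps) * #|S|%:R ^+ 2.
    by rewrite mulr_ge0 ?addr_ge0 ?exprn_ge0 // ltW.
  lra.
move=> x xS.
have cS : #|S| = #|S :\ x|.+1 by rewrite (cardsD1 x) xS.
have DSx : D S = (D (S :\ x) + 2 * #|nbhd x :&: S|)%N.
  have nx : #|nbhd x :&: S| = #|nbhd x :&: (S :\ x)|.
    apply: eq_card => z; rewrite !inE; case: eqP => [->|] //=.
    by rewrite adj_irr.
  rewrite /D (big_setD1 x) //= mul2n -addnn addnCA; congr (_ + _)%N.
  transitivity (\sum_(w in S :\ x) (#|nbhd w :&: (S :\ x)| + G w x))%N.
    apply: eq_bigr => w wS; rewrite !card_nbhdI (big_setD1 x) //=.
    by rewrite addnC.
  rewrite big_split /= addnC nx card_nbhdI addnC; congr (_ + _)%N.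
  by apply: eq_bigr => w _; rewrite adj_sym.
have := Smax (S :\ x); rewrite (subset_trans (subsetDl _ _) SW) => /(_ isT).
rewrite /f DSx cS natrD natrM -natr1.
set a := #|_|%:R; set c := (D _)%:R; set n := #|_|%:R.
nra.
Qed.

End Cliques.

Section Tiles.

Variables (V : finType) (G : sgraph V) (M : nat) (lab : V -> 'I_M).
Variables (r m s : nat).
Hypothesis r0 : (0 < r)%N.
Implicit Types (N S W X Y : {set V}).

(** [t] is the scale, and [i0] is the neck, the part of size [t * s]. *)
Definition is_tile (t : nat) (A : 'I_r.+1 -> {set V}) : Prop :=
  clique G lab A /\
  exists i0, forall i, #|A i| = (t * if i == i0 then s else m)%N.

Inductive tiled (t : nat) : {set V} -> Prop :=
| tiled_nil : tiled t set0
| tiled_cons A X : is_tile t A -> tiled t X -> [disjoint \bigcup_i A i & X] ->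
    tiled t ((\bigcup_i A i) :|: X).

Lemma tiled_tile t A : is_tile t A -> tiled t (\bigcup_i A i).
Proof.
move=> tA; rewrite -[X in tiled t X]setU0; apply: tiled_cons => //.
  exact: tiled_nil.
by rewrite -setI_eq0 setI0.
Qed.

Lemma tiledU t X Y : tiled t X -> tiled t Y -> [disjoint X & Y] ->
  tiled t (X :|: Y).
Proof.
move=> tX tY; elim: tX => [|A X' tA tX' IH dAX]; first by rewrite set0U.
rewrite -setI_eq0 setIUl setU_eq0 !setI_eq0 => /andP[dAY dXY].
rewrite -setUA; apply: tiled_cons => //; first exact: IH.
by rewrite -setI_eq0 setIUr setU_eq0 !setI_eq0 dAX.
Qed.

Lemma card_tile t A : is_tile t A -> #|\bigcup_i A i| = (t * (r * m + s))%N.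
Proof.
move=> [cA [i0 sA]].
rewrite (card_clique cA) (bigD1 i0) //= sA eqxx mulnDr addnC; congr (_ + _)%N.
under eq_bigr => i /negbTE ni do rewrite sA ni.
by rewrite sum_nat_const cardC1 card_ord mulnCA.
Qed.

(* The vector is x times that of a tile with neck i0, plus y times the sum of
   those of the tiles with neck i1, for all i1 != i0. *)
Lemma tiled_clique t x y (A : 'I_r.+1 -> {set V}) i0 :
  clique G lab A ->
  (forall i, #|A i| = t * if i == i0 then x * s + y * (r * m)
                          else x * m + y * (r.-1 * m + s))%N ->
  tiled t (\bigcup_i A i).
Proof.
pose I := 'I_r.+1.
pose fS := @clique_sub V G M lab I; pose fD := @clique_disjoint V G M lab I.
have tT (i1 : I) : tileable (@clique V G M lab I) (tiled t)
    (fun i => t * if i == i1 then s else m)%N.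
  by move=> B cB sB; apply: tiled_tile; split=> //; exists i1.
have tot (i : I) : (\sum_(i1 : I) (t * if i == i1 then s else m) =
    t * (r * m + s))%N.
  rewrite (bigD1 i) //= eqxx.
  under eq_bigr => i1 ni do rewrite eq_sym (negbTE ni).
  by rewrite sum_nat_const cardC1 card_ord; lia.
have tN := tileableD fS fD (@tiledU t)
  (tileableM fS fD (tiled_nil t) (@tiledU t) (n := x) (tT i0))
  (tileableM fS fD (tiled_nil t) (@tiledU t) (n := y)
    (tileable_sum fS fD (tiled_nil t) (@tiledU t) (P := predC1 i0)
      (fun j _ => tT j))).
move=> cA sA; apply: tN => // i; rewrite sA.
have := tot i; rewrite (bigD1 i0) //=; set S := (\sum_(_ < _ | _) _)%N.
case: eqP => _ e.
  have -> : S = (t * (r * m))%N by lia.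
  lia.
have -> : S = (t * (r.-1 * m + s))%N by case: (r) r0 e => // r' _; lia.
lia.
Qed.

(** A tile of scale [q * t] splits into [q] tiles of scale [t] with the same neck. *)
Lemma tiled_rescale q t X : tiled (q * t) X -> tiled t X.
Proof.
elim=> [|A Y [cA [i0 sA]] _ tY dAY]; first exact: tiled_nil.
apply: tiledU => //; apply: (@tiled_clique t q 0 A i0) => // i.
by rewrite sA; case: eqP => _; lia.
Qed.

(** Both sides of the inequality are additive over the tiles, so one tile satisfies it. *)
Lemma tiled_pick (R : realType) (d : R) t W X :
  tiled t X ->
  d * #|W|%:R * #|X|%:R < (\sum_(w in W) #|nbhd G w :&: X|)%:R ->
  exists A Y, [/\ is_tile t A, tiled t Y, [disjoint \bigcup_i A i & Y],
    X = (\bigcup_i A i) :|: Y &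
    d * #|W|%:R * #|\bigcup_i A i|%:R <
      (\sum_(w in W) #|nbhd G w :&: \bigcup_i A i|)%:R].
Proof.
elim=> [|A Y tA tY IH dAY].
  rewrite cards0 mulr0 big1 ?ltxx // => w _.
  by rewrite setI0 cards0.
have -> : (\sum_(w in W) #|nbhd G w :&: (\bigcup_i A i :|: Y)| =
  \sum_(w in W) #|nbhd G w :&: \bigcup_i A i| +
  \sum_(w in W) #|nbhd G w :&: Y|)%N.
  rewrite -big_split; apply: eq_bigr => w _ /=; rewrite setIUr cardsU_disjoint //.
  by apply: disjointWl (subsetIr _ _) _; apply: disjointWr (subsetIr _ _) _.
rewrite cardsU_disjoint // !natrD mulrDr.
have [gA|nA] := ltP (d * #|W|%:R * #|\bigcup_i A i|%:R)
   (\sum_(w in W) #|nbhd G w :&: \bigcup_i A i|)%:R.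
  by move=> _; exists A, Y; split.
move=> lt; have {}lt : d * #|W|%:R * #|Y|%:R < (\sum_(w in W) #|nbhd G w :&: Y|)%:R.
  lra.
have [B [Z [tB tZ dBZ eY gB]]] := IH lt.
move: dAY; rewrite eY -setI_eq0 setIUr setU_eq0 !setI_eq0 => /andP[dAB dAZ].
exists B, (\bigcup_i A i :|: Z); split=> //.
- by apply: tiled_cons.
- by rewrite -setI_eq0 setIUr setU_eq0 !setI_eq0 dBZ andbT disjoint_sym.
- by rewrite setUCA.
Qed.

(* The numbers are chosen so that p tiles per neck position in the first family
   and x tiles of the original kind together with y s tiles per other neck
   position in the second family use up everything. *)
Lemma retile q t (A : 'I_r.+1 -> {set V}) i0 N W :
  let e := (r.-1 * m + s)%N in let p := ((m - s) * (r * m + s))%N in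
  (s < m)%N -> (e * r * m <= q)%N ->
  clique G lab A -> (forall i, #|A i| = q * t * if i == i0 then s else m)%N ->
  joined G W N -> monolabel lab W -> #|W| = (p * r * m * t)%N ->
  (forall i, i != i0 -> p * e * t <= #|N :&: A i|)%N ->
  [disjoint \bigcup_i A i & W] ->
  tiled t ((\bigcup_i A i) :|: W).
Proof.
move=> e p sm qge cA sA jWN mW cW leN dAW.
(* This identity is what makes the sizes of the parts other than [i0] come out right in the second
   family. *)
have pos : (s * e + p = r * m * m)%N.
  rewrite /e /p; have [k ->] : exists k, m = (s + k)%N.
    by exists (m - s)%N; rewrite subnKC // ltnW.
  rewrite addKn; case: (r) r0 => // r' _ /=; lia.
have pqm : (p * e <= q * m)%N.
  apply: (@leq_trans (r * m * m * e)%N); first by rewrite leq_mul2r -pos leq_addl orbT.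
  by rewrite mulnAC leq_mul2r (mulnC _ e) mulnA qge orbT.
have /fin_all_exists [B BP] : forall i, exists B : {set V},
    B \subset N :&: A i /\ (i != i0 -> #|B| = p * e * t)%N.
  move=> i; have [->|ni] := eqVneq i i0; first by exists set0; rewrite sub0set.
  by have [B [? ?]] := subset_of_card (leN i ni); exists B.
have BA i : B i \subset A i by apply: subset_trans (BP i).1 (subsetIr _ _).
have BN i : B i \subset N by apply: subset_trans (BP i).1 (subsetIl _ _).
(* In the first family [W] takes position [i0]; the neck [A i0] goes entirely into the second
   family. *)
pose C1 i := if i == i0 then W else B i.
pose C2 i := if i == i0 then A i else A i :\: B i.
have tC1 : tiled t (\bigcup_i C1 i).
  apply: (@tiled_clique t 0 p C1 i0).
    have [mA jA] := cA; split=> [i|i j].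
      rewrite /C1; case: eqP => // _ x y xi yi.
      by apply: (mA i); apply: (subsetP (BA i)).
    rewrite /C1; have [->|ni] := eqVneq i i0.
      rewrite eq_sym => /negbTE -> x y xW yB.
      by apply: jWN => //; apply: (subsetP (BN j)).
    have [-> _|nj nij] := eqVneq j i0; move=> x y xB yB.
      by rewrite adj_sym; apply: jWN => //; apply: (subsetP (BN i)).
    by apply: (jA i j nij); [apply: (subsetP (BA i))|apply: (subsetP (BA j))].
  move=> i; rewrite /C1; case: eqP => [_|/eqP ni]; first by rewrite cW; lia.
  by rewrite (BP i).2 // -/e; lia.
have tC2 : tiled t (\bigcup_i C2 i).
  apply: (@tiled_clique t (q - e * r * m) (s * e) C2 i0).
    apply: clique_sub cA => i; rewrite /C2; case: eqP => // _; exact: subsetDl.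
  move=> i; rewrite /C2 -/e; have [k ek] : exists k, q = (e * r * m + k)%N.
    by exists (q - e * r * m)%N; rewrite subnKC.
  case: eqP => [->|/eqP ni]; first by rewrite sA eqxx ek addKn; lia.
  rewrite cardsD (setIidPr (BA i)) (BP i).2 // sA (negbTE ni) ek addKn.
  have -> : ((e * r * m + k) * t * m = t * (k * m + s * e * e) + p * e * t)%N.
    have -> : ((e * r * m + k) * t * m = t * (k * m) + t * e * (r * m * m))%N by lia.
    by rewrite -pos; lia.
  by rewrite addnK.
have -> : \bigcup_i A i :|: W = \bigcup_i C1 i :|: \bigcup_i C2 i.
  apply/setP => x; rewrite !inE; apply/orP/orP.
    case=> [/bigcupP[i _ xi]|xW].
      case iB : ((i != i0) && (x \in B i)).
        case/andP: iB => ni xB.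
        by left; apply/bigcupP; exists i => //; rewrite /C1 (negbTE ni).
      right; apply/bigcupP; exists i => //; rewrite /C2.
      by move: iB; case: eqP => //= _ xB; rewrite inE xB.
    by left; apply/bigcupP; exists i0 => //; rewrite /C1 eqxx.
  case=> /bigcupP[i _]; rewrite /C1 /C2; case: eqP => [ei|ni] xi.
  - by right.
  - by left; apply/bigcupP; exists i => //; apply: (subsetP (BA i)).
  - by left; apply/bigcupP; exists i.
  - by left; apply/bigcupP; exists i => //; apply: (subsetP (subsetDl _ _)) xi.
apply: tiledU => //; rewrite -setI_eq0; apply/eqP/setP => x; rewrite !inE.
apply/negP => /andP[/bigcupP[i _ xi] /bigcupP[j _ xj]].
have xA : x \in A j.
  move: xj; rewrite /C2; case: eqP => // _; exact: (subsetP (subsetDl _ _)).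
move: xi; rewrite /C1; case: eqP => [_ xW|/eqP ni xB].
  move: dAW; rewrite disjoint_sym disjoints_subset => /subsetP/(_ x xW).
  by rewrite inE => /negP; apply; apply/bigcupP; exists j.
have xAi := subsetP (BA i) x xB.
have [eij|nij] := eqVneq i j.
  by move: xj; rewrite /C2 -eij (negbTE ni) inE xB.
have := clique_disjoint cA nij.
by rewrite disjoints_subset => /subsetP/(_ x xAi); rewrite inE xA.
Qed.

End Tiles.

(* Erdos-Stone *)
Lemma clique_in_dense (R : realType) (M r : nat) (d eps : R) (j : nat) :
  0 < eps -> eps <= 1 -> 0 <= d -> r%:R - 1 <= d * r%:R -> (j <= r.+1)%N ->
  forall k : nat, exists N0 : nat,
  forall (V : finType) (G : sgraph V) (lab : V -> 'I_M) (S : {set V}),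
    (N0 <= #|S|)%N ->
    (forall x, x \in S -> (d + 2 * eps) * #|S|%:R <= #|nbhd G x :&: S|%:R) ->
  exists A : 'I_j -> {set V},
    [/\ clique G lab A, forall i, A i \subset S & forall i, #|A i| = k].
Proof.
move=> e0 e1 d0 dr; elim: j => [|j IHj] jr k.
  by exists 0%N => V G lab S _ _; exists (fun=> set0); split=> [|[]//|[]//]; split=> -[].
(* The [j] parts are first found with the larger size [k'], because passing to a common
   neighbourhood may keep only a proportion [eps] of each. *)
have [k' ltk'] := exists_natr_gt (k%:R / eps).
have kk' : k%:R <= eps * k'%:R by move: ltk'; rewrite ltr_pdivrMr // => /ltW; rewrite mulrC.
have [N1 N1P] := IHj (ltnW jr) k'.
have [N2 N2P] := exists_natr_gt ((2 ^ (j * k') * M * k)%:R / eps).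
exists (maxn N1 N2) => V G lab S; rewrite geq_max => /andP[leN1 leN2] degS.
have [A [cA AS sA]] := N1P V G lab S leN1 degS.
pose Q := \bigcup_i A i.
have cQ : #|Q| = (j * k')%N.
  by rewrite (card_clique cA); under eq_bigr do rewrite sA; rewrite sum_nat_const card_ord.
have QS : Q \subset S by apply/bigcupsP => i _.
have [||N [W [NQ WS cW [mW jWN leN]]]] :=
    @common_nbhd V G M lab R d eps Q S k e0 e1 d0.
- rewrite sum_card_nbhdI natr_sum [leLHS]mulrC [leLHS]mulr_natl -sumr_const.
  by apply: ler_sum => x xQ; apply: degS; apply: (subsetP QS).
- rewrite cQ mulrC -ltr_pdivrMr //; apply: lt_le_trans N2P _.
  by rewrite ler_nat.
(* The hypothesis says [d >= 1 - 1 / r], and it passes to [j <= r]. *)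
have dj : j%:R - 1 <= d * j%:R.
  have jr' : j%:R <= r%:R :> R by rewrite ler_nat.
  have j0 : 0 <= j%:R :> R by [].
  by have [d1|d1] := leP 1 d; nra.
(* The parts other than [A i] hold only [(j - 1) * k'] vertices of [N], while [N] has at least
   [(d + eps) * j * k'], so at least [eps * j * k'] of them lie in [A i]. *)
have leA i : (k <= #|N :&: A i|)%N.
  have AQ : A i \subset Q by apply: bigcup_sup.
  have := leq_cardI NQ AQ; rewrite sA cQ -(ler_nat R) !natrD natrM => leNA.
  move: leN; rewrite cQ natrM -(ler_nat R) => leN.
  have j1 : 1 <= j%:R :> R by rewrite ler1n; case: (i) => -[]; case: (j).
  have k0 : 0 <= k'%:R :> R by [].
  have h1 : 0 <= (d * j%:R - (j%:R - 1)) * k'%:R by rewrite mulr_ge0 // subr_ge0.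
  have h2 : 0 <= eps * k'%:R * (j%:R - 1) by rewrite !mulr_ge0 // ?subr_ge0 // ltW.
  lra.
have /fin_all_exists [B BP] : forall i, exists B : {set V}, B \subset N :&: A i /\ #|B| = k.
  by move=> i; apply: subset_of_card.
have BA i : B i \subset A i by apply: subset_trans (BP i).1 (subsetIr _ _).
have BN i : B i \subset N by apply: subset_trans (BP i).1 (subsetIl _ _).
have [mB jB] := clique_sub BA cA.
exists (fun i => if unlift ord0 i is Some i' then B i' else W); split.
- split=> [i|i i']; first by case: unliftP.
  case: unliftP => [a|] ->; case: unliftP => [a'|] -> //.
  + by rewrite (inj_eq lift_inj); apply: jB.
  + move=> _ x y xB yW; rewrite adj_sym; apply: jWN => //.
    exact: (subsetP (BN a)).
  + by move=> _ x y xW yB; apply: jWN => //; apply: (subsetP (BN a')).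
- move=> i; case: unliftP => [a|] _ //.
  exact: subset_trans (BA a) (AS a).
- by move=> i; case: unliftP => [a|] _ //; case: (BP a).
Qed.

(** [dense_subset] turns average degree into minimum degree, Erdos-Stone gives parts of size
    [t * m], and one of them is shrunk to form the neck. *)
Lemma tile_in_dense (R : realType) (M r m s t : nat) (d eps : R) :
  (s <= m)%N -> 0 < eps -> eps <= 1 -> 0 <= d -> r%:R - 1 <= d * r%:R ->
  exists N0 : nat,
  forall (V : finType) (G : sgraph V) (lab : V -> 'I_M) (W : {set V}),
    (N0 <= #|W|)%N ->
    (d + 4 * eps) * #|W|%:R * #|W|%:R <= (\sum_(w in W) #|nbhd G w :&: W|)%:R ->
  exists A : 'I_r.+1 -> {set V},
    is_tile G lab m s t A /\ \bigcup_i A i \subset W.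
Proof.
move=> sm e0 e1 d0 dr.
have h0 : 0 < eps / 2 by lra.
have [|N1 N1P] := clique_in_dense M h0 _ d0 dr (leqnn r.+1) (t * m); first by lra.
have [N2 N2P] := exists_natr_gt ((d + 2 * eps) / eps).
have [N3 N3P] := exists_natr_gt ((maxn N1 N2)%:R / eps).
exists N3 => V G lab W leW dW.
have [||S [SW cS degS]] := @dense_subset V G R d (2 * eps) W _ d0; first by lra.
  by move: dW; rewrite expr2; lra.
have leS : (maxn N1 N2 <= #|S|)%N.
  have h1 : (maxn N1 N2)%:R <= eps * #|W|%:R.
    move: N3P; rewrite ltr_pdivrMr // => /ltW/le_trans; apply.
    by rewrite mulrC ler_pM2l // ler_nat.
  rewrite -(ler_nat R) (le_trans h1) // -(@ler_pXn2r _ 2) ?nnegrE ?mulr_ge0 //; last exact: ltW.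
  apply: le_trans cS; rewrite exprMn ler_wpM2r ?exprn_ge0 //.
  by rewrite expr2; nra.
move: leS; rewrite geq_max => /andP[leN1 leN2].
have [|A [cA AS sA]] := N1P V G lab S leN1.
  move=> x xS; apply: le_trans (degS x xS).
  have : d + 2 * eps <= eps * #|S|%:R.
    move: N2P; rewrite ltr_pdivrMr // => /ltW/le_trans; apply.
    by rewrite mulrC ler_pM2l // ler_nat.
  lra.
have [B [BA cB]] : exists B : {set V}, B \subset A ord0 /\ #|B| = (t * s)%N.
  by apply: subset_of_card; rewrite sA leq_mul2l sm orbT.
exists (fun i => if i == ord0 then B else A i).
have sub i : (if i == ord0 then B else A i) \subset A i by case: eqP => // ->.
split; last by apply/bigcupsP => i _; apply: subset_trans (sub i) (subset_trans (AS i) SW).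
split; first exact: clique_sub sub cA.
by exists ord0 => i; case: eqP => // ->.
Qed.

(** * Improving a tiling by retiling at a smaller scale *)

Section Step.

Variables (R : realType) (M r m s q : nat) (d eps : R).

(** [b] is the size of a tile of scale 1 and [e = b - m], so [db] below says [d = 1 - m / b]; [p] is
    as in [retile]. *)
Let b := (r * m + s)%N.
Let e := (r.-1 * m + s)%N.
Let p := ((m - s) * b)%N.

Hypotheses (r0 : (0 < r)%N) (sm : (s < m)%N) (e0 : 0 < eps) (e1 : eps <= 1).
Hypothesis db : d * b%:R = e%:R.
Hypothesis qge : (e * r * m <= q)%N.
Hypothesis qbig : (p * e)%:R <= eps * (q * b)%:R.

(** [C * t] bounds the size of what one step tiles at scale [t]: a new tile, or an old tile of scale
    [q * t] with [p * r * m * t] added vertices. *)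
Let C := (q * b + p * r * m + b)%N.

Let b0 : (0 < b)%N. Proof. by rewrite /b addn_gt0 muln_gt0 r0 (leq_ltn_trans _ sm). Qed.

Let eb : (e + m = b)%N. Proof. by rewrite /e /b; case: (r) r0 => // r' _ /=; lia. Qed.

Let d0 : 0 <= d.
Proof. by rewrite -(@pmulr_lge0 _ b%:R) ?ltr0n // db. Qed.

(** This is the density that Erdos-Stone requires for [r.+1] parts. *)
Let dr : r%:R - 1 <= d * r%:R.
Proof.
rewrite -(@ler_pM2r _ b%:R) ?ltr0n // mulrAC db mulrBl mul1r -!natrM.
rewrite lerBlDr -natrD ler_nat.
by rewrite -eb /e; case: (r) r0 => // r' _ /=; lia.
Qed.

(** Either [W] is dense inside and contains a tile, or a tile [Q] of [X] is seen densely from [W]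
    and is retiled together with part of [W]. The rest [X'] keeps the scale [q * t], so that the
    step can be repeated. *)
Lemma tiling_step (t : nat) : (0 < t)%N -> exists N0 : nat,
  forall (V : finType) (G : sgraph V) (lab : V -> 'I_M) (W X : {set V}),
    (N0 <= #|W|)%N -> [disjoint X & W] -> tiled G lab r m s (q * t) X ->
    (d + 4 * eps) * #|W|%:R * (#|W|%:R + #|X|%:R) <=
      (\sum_(w in W) #|nbhd G w :&: W|)%:R + (\sum_(w in W) #|nbhd G w :&: X|)%:R ->
  exists X' Y, [/\ tiled G lab r m s (q * t) X', tiled G lab r m s t Y,
    [disjoint X' & Y], X' :|: Y \subset X :|: W &
    (#|X| + t <= #|X'| + #|Y|)%N /\ (#|Y| <= C * t)%N].
Proof.
move=> t0.
have [N1 N1P] := tile_in_dense M t (ltnW sm) e0 e1 d0 dr.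
pose K := (p * r * m * t)%N.
have [N2 N2P] := exists_natr_gt ((2 ^ (q * t * b) * M * K)%:R / eps).
exists (maxn N1 N2) => V G lab W X; rewrite geq_max => /andP[leN1 leN2] dXW tX dense.
have [dW|dW] := leP ((d + 4 * eps) * #|W|%:R * #|W|%:R)
    (\sum_(w in W) #|nbhd G w :&: W|)%:R.
  have [A [tA AW]] := N1P V G lab W leN1 dW.
  exists X, (\bigcup_i A i); split=> //.
  - exact: tiled_tile.
  - exact: disjointWr AW dXW.
  - exact: setUS.
  - by rewrite (card_tile tA) -/b leq_add2l leq_pmulr // mulnC leq_mul2r leq_addl orbT.
have {dW}dX : (d + 4 * eps) * #|W|%:R * #|X|%:R < (\sum_(w in W) #|nbhd G w :&: X|)%:R.
  lra.
have [A [Y [tA tY dAY eX dA]]] := tiled_pick tX dX.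
pose Q := \bigcup_i A i; have cQ : #|Q| = (q * t * b)%N by rewrite (card_tile tA).
have [||N [W' [NQ W'W cW' [mW' jW'N leN]]]] :=
    @common_nbhd V G M lab R d eps Q W K e0 e1 d0.
- apply: le_trans (ltW dA); rewrite -/Q -!mulrA ler_wpM2r ?mulr_ge0 //.
  by rewrite lerD2l ler_wpM2r ?ler_nat // ltW.
- rewrite cQ mulrC -ltr_pdivrMr //; apply: lt_le_trans N2P _.
  by rewrite ler_nat.
have [cA [i0 sA]] := tA.
have QX : Q \subset X by rewrite eX subsetUl.
have dQW' : [disjoint Q & W'] by apply: disjointWl QX _; apply: disjointWr W'W _.
have tQW' : tiled G lab r m s t (Q :|: W').
  apply: (@retile V G M lab r m s r0 q t A i0 N W') => // i ni.
  have AQ : A i \subset Q by apply: bigcup_sup.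
  have := leq_cardI NQ AQ; rewrite sA (negbTE ni) cQ -/b -/e -/p => leNA.
  rewrite -(leq_add2r (q * t * e)) -(ler_nat R).
  have {}leNA : (#|N| <= #|N :&: A i| + q * t * e)%N.
    by rewrite -(leq_add2r (q * t * m)) (leq_trans leNA) // -eb mulnDr addnA.
  move: leNA; rewrite -(ler_nat R); apply: le_trans; apply: le_trans leN.
  rewrite cQ natrD mulrDl addrC.
  have -> : d * (q * t * b)%:R = (q * t * e)%:R by rewrite [(q * t * b)%:R]natrM mulrCA db [RHS]natrM.
  rewrite lerD2l (mulnAC q t b) [(p * e * t)%:R]natrM [(q * b * t)%:R]natrM mulrA.
  by rewrite ler_wpM2r.
exists Y, (Q :|: W'); split=> //.
- rewrite disjoint_sym -setI_eq0 setIUl setU_eq0 !setI_eq0 dAY /=.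
  rewrite disjoint_sym; apply: disjointWr W'W _; apply: disjointWl dXW.
  by rewrite eX subsetUr.
- rewrite eX -/Q !subUset !(subset_trans W'W (subsetUr _ _)) andbT.
  by rewrite -setUA subsetUl (subset_trans (subsetUl Y W)) // subsetUr.
have cQW' : #|Q :|: W'| = (q * t * b + K)%N.
  by rewrite cardsU_disjoint // cQ cW'.
have p0 : (0 < p * r * m)%N by rewrite !muln_gt0 subn_gt0 sm b0 r0 (leq_ltn_trans _ sm).
split.
  have -> : #|X| = (#|Q| + #|Y|)%N.
    by rewrite eX cardsU_disjoint //.
  by rewrite cQW' cQ (addnC _ #|Y|) -addnA !leq_add2l /K leq_pmull.
by rewrite cQW' /C !mulnDl (mulnAC q t b) leq_addr.
Qed.

(** The step is repeated a number of times linear in [#|V|]. Each step gains [t] vertices and moves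
    at most [C * t] to the small scale, so the total gain is a proportion of [#|V|] independent of
    [t]. *)
Lemma tiling_round (eta : R) (t : nat) : (0 < t)%N -> 0 < eta ->
  exists N0 : nat,
  forall (V : finType) (G : sgraph V) (lab : V -> 'I_M) (X0 : {set V}),
    (N0 <= #|V|)%N ->
    (forall x, (d + 5 * eps) * #|V|%:R <= (degree G x)%:R) ->
    tiled G lab r m s (q * t) X0 ->
  exists X, tiled G lab r m s t X /\
    ((1 - eta) * #|V|%:R <= #|X|%:R \/
     #|X0|%:R + eps / (2 * C%:R) * #|V|%:R <= #|X|%:R).
Proof.
move=> t0 eta0.
have C0 : (0 < C)%N by rewrite /C addn_gt0 b0 orbT.
have [N1 N1P] := tiling_step t0.
have [N2 N2P] := exists_natr_gt (N1%:R / eta).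
have [N3 N3P] := exists_natr_gt (2 * C%:R * t%:R / eps).
exists (maxn N2 N3) => V G lab X0; rewrite geq_max => /andP[leN2 leN3] degG tX0.
have [[X [tX bigX]]|small] := boolp.pselect (exists X, tiled G lab r m s t X /\
    (1 - eta) * #|V|%:R <= #|X|%:R); first by exists X; split; [|left].
(* [D] collects what is already tiled at scale [t]. It is kept below [eps * #|V|], since only the
   tiles of [X] are available for retiling. *)
have iter j : (j * (C * t))%:R <= eps * #|V|%:R -> exists X D,
    [/\ tiled G lab r m s (q * t) X, tiled G lab r m s t D, [disjoint X & D],
      (#|D| <= j * (C * t))%N & (#|X0| + j * t <= #|X| + #|D|)%N].
  elim: j => [_|j IHj jle].
    exists X0, set0; split=> //; first exact: tiled_nil.
    - by rewrite -setI_eq0 setI0.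
    - by rewrite cards0.
    - by rewrite cards0 mul0n.
  have [|X [D [tX tD dXD cD leX]]] := IHj.
    by apply: le_trans jle; rewrite ler_nat leq_mul2r leqnSn orbT.
  pose W := ~: (X :|: D).
  have cXD : #|X :|: D| = (#|X| + #|D|)%N.
    by rewrite cardsU_disjoint //.
  have cV : (#|X| + #|D| + #|W| = #|V|)%N by rewrite -cXD cardsC.
  have leW : (N1 <= #|W|)%N.
    rewrite -(ler_nat R); have h1 : N1%:R <= eta * #|V|%:R.
      move: N2P; rewrite ltr_pdivrMr // => /ltW/le_trans; apply.
      by rewrite mulrC ler_pM2l // ler_nat.
    apply: le_trans h1 _; rewrite leNgt; apply/negP => ltW'; apply: small.
    exists (X :|: D); split.
      by apply: tiledU => //; apply: tiled_rescale tX.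
    by rewrite cXD; move: ltW'; rewrite -[in #|V|%:R]cV !natrD; lra.
  have dXW : [disjoint X & W] by rewrite disjoints_subset setCK subsetUl.
  have dDW : [disjoint D & W] by rewrite disjoints_subset setCK subsetUr.
  have [|X' [Y [tX' tY dXY sXY [geXY cY]]]] := N1P V G lab W X leW dXW tX.
    rewrite -[leRHS]natrD -big_split /= natr_sum.
    have -> : (d + 4 * eps) * #|W|%:R * (#|W|%:R + #|X|%:R) =
        \sum_(w in W) (d + 4 * eps) * (#|W|%:R + #|X|%:R).
      by rewrite sumr_const -[RHS]mulr_natl; ring.
    (* At most [eps * #|V|] neighbours of [w] lie in [D], which lowers [5 * eps] to [4 * eps]. *)
    apply: ler_sum => w wW.
    have degw : (degree G w <= #|nbhd G w :&: W| + #|nbhd G w :&: X| + #|D|)%N.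
      apply: (@leq_trans (#|nbhd G w :&: W :|: nbhd G w :&: X :|: D|)).
        apply: subset_leq_card; apply/subsetP => x; rewrite !inE.
        by move=> ->; case: (x \in X); case: (x \in D).
      apply: leq_trans (leq_card_setU _ _) _; rewrite leq_add2r.
      exact: leq_card_setU.
    have := degG w; move: degw; rewrite -(ler_nat R) natrD.
    have : #|D|%:R <= eps * #|V|%:R.
      apply: le_trans jle; rewrite ler_nat; apply: leq_trans cD _.
      by rewrite leq_mul2r leqnSn orbT.
    have : #|W|%:R + #|X|%:R <= #|V|%:R :> R.
      by rewrite -natrD ler_nat -cV addnC leq_add2r leq_addr.
    have := d0; have := e0.
    set w1 := (_ + _)%:R; set n := #|V|%:R; nra.
  exists X', (D :|: Y).
  have dD : [disjoint D & X' :|: Y].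
    apply: disjointWr sXY _; rewrite -setI_eq0 setIUr setU_eq0 !setI_eq0.
    by rewrite dDW disjoint_sym dXD.
  move: dD; rewrite -setI_eq0 setIUr setU_eq0 !setI_eq0 => /andP[dDX' dDY].
  have cDY : #|D :|: Y| = (#|D| + #|Y|)%N.
    by rewrite cardsU_disjoint //.
  split=> //; first exact: tiledU.
  - by rewrite -setI_eq0 setIUr setU_eq0 !setI_eq0 dXY disjoint_sym dDX'.
  - by rewrite cDY mulSn addnC leq_add.
  - rewrite cDY mulSn addnCA addnC.
    apply: leq_trans (leq_add leX (leqnn t)) _.
    by rewrite addnAC [leqRHS]addnCA [leqRHS]addnC leq_add2r.
(* This is the largest number of steps that [iter] allows; the factor 2 in the claimed gain absorbs
   the rounding. *)
pose J := Num.truncn (eps * #|V|%:R / (C * t)%:R).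
have Ct0 : 0 < (C * t)%:R :> R by rewrite ltr0n muln_gt0 C0.
have J0 : 0 <= eps * #|V|%:R / (C * t)%:R :> R.
  by rewrite divr_ge0 ?mulr_ge0 // ltW.
have [X [D [tX tD dXD _ leXD]]] : exists X D,
    [/\ tiled G lab r m s (q * t) X, tiled G lab r m s t D, [disjoint X & D],
      (#|D| <= J * (C * t))%N & (#|X0| + J * t <= #|X| + #|D|)%N].
  by apply: iter; rewrite natrM -ler_pdivlMr // truncn_le.
exists (X :|: D); split; first by apply: tiledU => //; apply: tiled_rescale tX.
right; rewrite cardsU_disjoint //.
apply: (@le_trans _ _ (#|X0| + J * t)%:R); last by rewrite ler_nat.
rewrite natrD lerD2l natrM.
have Jlt : eps * #|V|%:R < (J%:R + 1) * (C%:R * t%:R).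
  by rewrite -natrM natr1 -ltr_pdivrMr // truncnS_gt.
have C0' : 0 < C%:R :> R by rewrite ltr0n.
have leV : 2 * C%:R * t%:R <= eps * #|V|%:R.
  move: N3P; rewrite ltr_pdivrMr // => /ltW/le_trans; apply.
  by rewrite mulrC ler_pM2l // ler_nat.
rewrite mulrAC ler_pdivrMr; lra.
Qed.

End Step.

Theorem almost_tiling (R : realType) (M r m s : nat) (d eps eta : R) :
  (0 < r)%N -> (s < m)%N -> 0 < eps -> eps <= 1 -> 0 < eta ->
  d * (r * m + s)%:R = (r.-1 * m + s)%:R ->
  exists N0 : nat, forall (V : finType) (G : sgraph V) (lab : V -> 'I_M),
    (N0 <= #|V|)%N ->
    (forall x, (d + 5 * eps) * #|V|%:R <= (degree G x)%:R) ->
  exists X, tiled G lab r m s 1 X /\ (1 - eta) * #|V|%:R <= #|X|%:R.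
Proof.
move=> r0 sm e0 e1 eta0 db.
pose b := (r * m + s)%N; pose e := (r.-1 * m + s)%N; pose p := ((m - s) * b)%N.
have b0 : (0 < b)%N by rewrite /b addn_gt0 muln_gt0 r0 (leq_ltn_trans _ sm).
have [q1 q1P] := exists_natr_gt ((p * e)%:R / eps).
pose q := maxn q1.+1 (e * r * m).
have qge : (e * r * m <= q)%N by apply: leq_maxr.
have qbig : (p * e)%:R <= eps * (q * b)%:R.
  rewrite mulrC -ler_pdivrMr //; apply: (le_trans (ltW q1P)); rewrite ler_nat.
  by apply: (@leq_trans q); [apply: ltnW (leq_maxl _ _)|apply: leq_pmulr].
have q0 : (0 < q)%N by apply: leq_trans (leq_maxl _ _).
pose C := (q * b + p * r * m + b)%N.
pose gam := eps / (2 * C%:R).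
have gam0 : 0 < gam.
  by rewrite divr_gt0 // mulr_gt0 // ltr0n /C addn_gt0 b0 orbT.
have main i : forall t, (0 < t)%N -> exists N0 : nat,
    forall (V : finType) (G : sgraph V) (lab : V -> 'I_M),
    (N0 <= #|V|)%N ->
    (forall x, (d + 5 * eps) * #|V|%:R <= (degree G x)%:R) ->
  exists X, tiled G lab r m s t X /\
    ((1 - eta) * #|V|%:R <= #|X|%:R \/ i%:R * gam * #|V|%:R <= #|X|%:R).
  elim: i => [|i IHi] t t0.
    exists 0%N => V G lab _ _; exists set0; split; first exact: tiled_nil.
    by right; rewrite !mul0r.
  have [|N1 N1P] := IHi (q * t)%N; first by rewrite muln_gt0 q0.
  have [N2 N2P] := tiling_round M r0 sm e0 e1 db qge qbig t0 eta0.
  exists (maxn N1 N2) => V G lab; rewrite geq_max => /andP[leN1 leN2] degG.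
  have [X0 [tX0 cX0]] := N1P V G lab leN1 degG.
  case: cX0 => [cX0|cX0].
    by exists X0; split; [apply: tiled_rescale tX0|left].
  have [X [tX [cX|cX]]] := N2P V G lab X0 leN2 degG tX0.
    by exists X; split; [|left].
  exists X; split=> //; right; apply: le_trans cX.
  by rewrite -natr1 mulrDl mul1r mulrDl lerD2r.
(* After more than [1 / gam] rounds the second alternative also gives full coverage. *)
have [i iP] := exists_natr_gt gam^-1.
have [N0 N0P] := main i 1%N isT.
exists N0 => V G lab leN degG; have [X [tX [cX|cX]]] := N0P V G lab leN degG.
  by exists X.
exists X; split=> //; apply: le_trans cX; rewrite ler_wpM2r //.
have : 1 <= i%:R * gam by rewrite -ler_pdivrMr // mul1r ltW.
lra.
Qed.

(** * From bottlegraphs to tiles *)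

Lemma bigminn_le (I : finType) (P : pred I) (F : I -> nat) (x : nat) (i : I) :
  P i -> (\big[minn/x]_(j | P j) F j <= F i)%N.
Proof.
move=> Pi; have := mem_index_enum i; elim: (index_enum I) => // j l IH.
rewrite inE big_cons => /predU1P[<-|il]; first by rewrite Pi geq_minl.
by case: ifP => _; [rewrite geq_min IH ?orbT|apply: IH].
Qed.

Lemma le_bigminn (I : finType) (P : pred I) (F : I -> nat) (x m : nat) :
  (m <= x)%N -> (forall i, P i -> (m <= F i)%N) ->
  (m <= \big[minn/x]_(j | P j) F j)%N.
Proof.
move=> mx mF; apply: (big_ind (fun y => m <= y)%N) => // y z my mz.
by rewrite leq_min my.
Qed.

Section CompletePartite.

Variables (b k : nat) (B : sgraph 'I_b) (U : 'I_b -> 'I_k).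
Hypothesis BU : complete_partite B U.

Lemma chi_complete_partite : chi B = k.
Proof.
have [surU adjU] := BU.
have /fin_all_exists[rep repP] := surU.
rewrite /chi; case: ex_minnP => c /existsP[col /forallP colP] cmin.
apply/eqP; rewrite eqn_leq cmin /=; last first.
  apply/existsP; exists [ffun x => U x].
  apply/forallP => x; apply/forallP => y; rewrite !ffunE adjU.
  by apply/implyP.
have inj : injective (fun i => col (rep i)).
  move=> i j /eqP; apply: contraTeq => nij.
  move: (colP (rep i)) => /forallP/(_ (rep j))/implyP; apply.
  by rewrite adjU !repP.
by have := leq_card _ inj; rewrite !card_ord.
Qed.

(** In a proper colouring with [k] colours, representatives of the [k] parts use all the colours, so
    each colour class contains a whole part. *)
Lemma sigma_complete_partite (i0 : 'I_k) :
  (forall i, (#|[set x | U x == i0]| <= #|[set x | U x == i]|)%N) ->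
  sigma B = #|[set x | U x == i0]|.
Proof.
move=> mini; have [surU adjU] := BU.
have /fin_all_exists[rep repP] := surU.
rewrite /sigma chi_complete_partite; apply/eqP; rewrite eqn_leq; apply/andP; split.
  apply: (@leq_trans (\big[minn/#|'I_b|]_(i < k)
      #|[set x | [ffun x => U x] x == i]%SET|)).
    apply: (bigminn_le (fun c : {ffun 'I_b -> 'I_k} =>
      \big[minn/#|'I_b|]_(i < k) #|[set x | c x == i]%SET|)).
    apply/forallP => x; apply/forallP => y; rewrite !ffunE adjU.
    by apply/implyP.
  apply: leq_trans (bigminn_le _ _ (i := i0) _) _ => //.
  by apply: subset_leq_card; apply/subsetP => x; rewrite !inE ffunE.
apply: le_bigminn => [|col /forallP colP]; first exact: max_card.
have inj : injective (fun i => col (rep i)).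
  move=> i j /eqP; apply: contraTeq => nij.
  move: (colP (rep i)) => /forallP/(_ (rep j))/implyP; apply.
  by rewrite adjU !repP.
have [g gK Kg] := injF_bij inj.
apply: le_bigminn => [|i _]; first exact: max_card.
apply: leq_trans (mini (g i)) _; apply: subset_leq_card.
apply/subsetP => x; rewrite !inE => /eqP Ux.
have cx : col x = col (rep (g (col x))) by rewrite Kg.
have [j ej] : exists j, col x = col (rep j) by exists (g (col x)).
have Uxj : U x = j.
  apply/eqP; apply: contraTT isT => nU.
  move: (colP x) => /forallP/(_ (rep j))/implyP; rewrite adjU repP ej eqxx.
  by move=> /(_ nU).
by rewrite ej -Uxj Ux Kg.
Qed.

End CompletePartite.

Section HTilings.

Variables (h : nat) (H : ordered_graph h).

Definition htiled (n : nat) (G : ordered_graph n) (X : {set 'I_n}) : Prop :=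
  exists T, is_tiling H G T /\ covered T = X.

Lemma htiled0 n (G : ordered_graph n) : htiled G set0.
Proof.
exists set0; split; last by rewrite /covered big_set0.
by split=> f; rewrite inE.
Qed.

Lemma mem_covered n (T : {set {ffun 'I_h -> 'I_n}}) f i : f \in T -> f i \in covered T.
Proof. by move=> fT; apply/bigcupP; exists f; rewrite // inE codom_f. Qed.

Lemma htiledU n (G : ordered_graph n) (X Y : {set 'I_n}) :
  htiled G X -> htiled G Y -> [disjoint X & Y] -> htiled G (X :|: Y).
Proof.
move=> [T [[eT dT] <-]] [S [[eS dS] <-]] dTS.
have dis f g : f \in T -> g \in S -> [disjoint codom f & codom g].
  move=> fT gS; rewrite disjoint_subset; apply/subsetP => x /codomP[i ->].
  rewrite inE; apply/codomP => -[j fgij].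
  move: dTS; rewrite disjoints_subset => /subsetP/(_ _ (mem_covered i fT)).
  by rewrite inE fgij mem_covered.
exists (T :|: S); split; last by rewrite /covered bigcup_setU.
split=> [f|f g]; first by rewrite inE => /orP[/eT|/eS].
rewrite !inE => /orP[fT|fS] /orP[gT|gS] nfg.
- exact: dT.
- exact: dis.
- by rewrite disjoint_sym dis.
- exact: dS.
Qed.

End HTilings.

Lemma enum_set_lt (n : nat) (A : {set 'I_n}) (d : 'I_n) (i j : nat) :
  (i < j)%N -> (j < #|A|)%N -> (nth d (enum A) i < nth d (enum A) j)%N.
Proof.
move=> ij jA.
have sA : sorted ltn (map val (enum A)).
  have -> : map val (enum A) = filter (fun x => x \in map val (enum A)) (iota 0 n).
    apply: (irr_sorted_eq ltn_trans ltnn).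
    - rewrite sorted_map; have : sorted (relpre val ltn) (enum 'I_n).
        by rewrite -sorted_map val_enum_ord iota_ltn_sorted.
      rewrite enumT; rewrite /enum_mem -enumT; apply: sorted_filter.
      by move=> x y z; apply: ltn_trans.
    - by apply: sorted_filter; [apply: ltn_trans|apply: iota_ltn_sorted].
    - move=> x; rewrite mem_filter mem_iota; apply/idP/andP => [xA|[]//].
      by split=> //; case/mapP: xA => y _ ->; rewrite leq0n add0n ltn_ord.
  by apply: sorted_filter; [apply: ltn_trans|apply: iota_ltn_sorted].
have szA : size (enum A) = #|A| by rewrite -cardE.
rewrite -!(nth_map d (val d)) ?szA ?(ltn_trans ij jA) //.
by apply: (sorted_ltn_nth ltn_trans) => //; rewrite inE size_map szA // (ltn_trans ij jA).
Qed.

(* x is sent to the element of A (c x) of the same rank as x among the points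
   of its colour. *)
Lemma ranked_embedding (N n : nat) (I : finType) (c : 'I_N -> I)
    (A : I -> {set 'I_n}) :
  (forall i, #|A i| = #|[set x | c x == i]|) ->
  (forall x y : 'I_N, (x < y)%N -> c x != c y ->
     forall u v : 'I_n, u \in A (c x) -> v \in A (c y) -> (u < v)%N) ->
  exists f : 'I_N -> 'I_n,
    [/\ forall x y : 'I_N, (x < y)%N -> (f x < f y)%N,
        forall x, f x \in A (c x) & f @: [set: 'I_N] = \bigcup_i A i].
Proof.
move=> cA ordA.
pose rk (x : 'I_N) := #|[set y : 'I_N | (y < x)%N && (c y == c x)]|.
have rkA x : (rk x < #|A (c x)|)%N.
  rewrite cA; apply: proper_card; apply/properP; split.
    by apply/subsetP => y; rewrite !inE => /andP[].
  by exists x; rewrite !inE ?eqxx // ltnn.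
(* The rank is in range, so the value does not depend on the default [d]; this lets two values in
   one part be compared with a common default. *)
have /fin_all_exists [f fP] : forall x, exists v, forall d, v = nth d (enum (A (c x))) (rk x).
  move=> x; have /card_gt0P[v0 _] := leq_ltn_trans (leq0n _) (rkA x).
  exists (nth v0 (enum (A (c x))) (rk x)) => d.
  by apply: set_nth_default; rewrite -cardE.
have fA x : f x \in A (c x).
  by rewrite (fP x (f x)) -mem_enum mem_nth // -cardE.
have fmono (x y : 'I_N) : (x < y)%N -> (f x < f y)%N.
  move=> xy; have [exy|nxy] := eqVneq (c x) (c y); last exact: (ordA x y).
  rewrite (fP x (f x)) (fP y (f x)) exy; apply: enum_set_lt => //.
  apply: proper_card; apply/properP; split.
    apply/subsetP => z; rewrite !inE => /andP[zx /eqP ->].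
    by rewrite exy eqxx (ltn_trans zx xy).
  by exists x; rewrite !inE ?ltnn // xy exy eqxx.
have finj : injective f.
  move=> x y fxy; apply: val_inj; case: (ltngtP x y) => // /fmono;
  by rewrite fxy ltnn.
exists f; split=> //; apply/setP => v; apply/imsetP/bigcupP.
  by move=> [x _ ->]; exists (c x).
move=> [i _ vi]; have : f @: [set x | c x == i] == A i.
  rewrite eqEcard card_imset // cA leqnn andbT.
  by apply/subsetP => u /imsetP[x]; rewrite inE => /eqP <- ->.
by move=> /eqP eA; move: vi; rewrite -eA => /imsetP[x _ ->]; exists x.
Qed.

(** [s i] is the rank of [f i] among the values of [f]. *)
Lemma perm_of_inj (k : nat) (f : 'I_k -> nat) : injective f ->
  exists s : 'S_k, forall i j, (f i < f j)%N -> (s i < s j)%N.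
Proof.
move=> finj; pose rk (i : 'I_k) := #|[set j | (f j < f i)%N]|.
have rkk i : (rk i < k)%N.
  rewrite -[X in (_ < X)%N]card_ord -cardsT; apply: proper_card; apply/properP.
  by split; [apply/subsetP => j; rewrite inE|exists i; rewrite !inE ?ltnn].
have rkm i j : (f i < f j)%N -> (rk i < rk j)%N.
  move=> ij; apply: proper_card; apply/properP; split.
    by apply/subsetP => l; rewrite !inE => /ltn_trans; apply.
  by exists i; rewrite !inE // ltnn.
pose g i := Ordinal (rkk i).
have ginj : injective g.
  move=> i j [eij]; apply: finj; case: (ltngtP (f i) (f j)) => // /rkm;
  by rewrite eij ltnn.
by exists (perm ginj) => i j /rkm; rewrite !permE.
Qed.

Lemma interval_labelling_exists (b k : nat) (U : 'I_b -> 'I_k) (s : 'S_k) :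
  exists phi, interval_labelling U s phi.
Proof.
(* Vertices are ordered lexicographically, first by the position of their part. *)
pose f (x : 'I_b) := (s (U x) * b + x)%N.
have finj : injective f.
  move=> x y fxy; apply: val_inj => /=.
  by have := congr1 (modn^~ b) fxy; rewrite /f !modnMDl !modn_small.
have [phi phiP] := perm_of_inj finj; exists phi => x y sxy.
apply: phiP; rewrite /f; apply: (@leq_trans (s (U x) * b + b)).
  by rewrite ltn_add2l.
by rewrite -mulSnr (leq_trans _ (leq_addr _ _)) // leq_mul2r sxy orbT.
Qed.

Lemma card_block (b t : nat) (j : 'I_b) :
  #|[set x : 'I_(b * t) | block x == j]| = t.
Proof.
have lt (i : 'I_t) : (j * t + i < b * t)%N.
  apply: (@leq_trans (j * t + t)); first by rewrite ltn_add2l.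
  by rewrite -mulSnr leq_mul2r ltn_ord orbT.
pose g i := Ordinal (lt i).
have ginj : injective g.
  by move=> i i' [/addnI e]; apply: val_inj.
rewrite -[RHS]card_ord -(card_imset _ ginj) -[in RHS]cardsE; apply: eq_card => x.
rewrite !inE; apply/eqP/imsetP => [e|[i _ ->]].
  have t0 : (0 < t)%N.
    by have := leq_ltn_trans (leq0n x) (ltn_ord x); rewrite muln_gt0 => /andP[].
  exists (Ordinal (ltn_pmod x t0)) => //.
  by apply: val_inj; rewrite /= -(congr1 val e) -divn_eq.
apply: val_inj => /=; have t0 : (0 < t)%N by case: (t) i => [[]|].
by rewrite divnMDl // divn_small ?addn0.
Qed.

Lemma card_blocks (b t : nat) (P : pred 'I_b) :
  #|[set x : 'I_(b * t) | P (block x)]| = (t * #|[set j | P j]|)%N.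
Proof.
rewrite -sum1_card (partition_big (@block b t) P) /=; last by move=> x; rewrite inE.
rewrite [RHS]mulnC -[RHS]sum_nat_const; apply: eq_big => [j|j Pj]; first by rewrite inE.
rewrite sum1dep_card -[RHS](card_block t j); apply: eq_card => x; rewrite !inE.
by apply/andP/eqP => [[_ /eqP //]|e]; rewrite e Pj eqxx.
Qed.

(** Deleting the edges inside intervals forces nonempty parts of a clique into distinct intervals,
    so that the parts are ordered. *)
Definition cut_adj (V : finType) (G : sgraph V) (M : nat) (lab : V -> 'I_M) :
  rel V := fun x y => G x y && (lab x != lab y).

Lemma cut_sym (V : finType) (G : sgraph V) (M : nat) (lab : V -> 'I_M) :
  symmetric (cut_adj G lab).
Proof. by move=> x y; rewrite /cut_adj adj_sym eq_sym. Qed.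

Lemma cut_irr (V : finType) (G : sgraph V) (M : nat) (lab : V -> 'I_M) :
  irreflexive (cut_adj G lab).
Proof. by move=> x; rewrite /cut_adj adj_irr. Qed.

Definition cut (V : finType) (G : sgraph V) (M : nat) (lab : V -> 'I_M) :
  sgraph V := SGraph (cut_sym G lab) (cut_irr G lab).

Section BottleTiles.

Variables (h : nat) (H : ordered_graph h).

Definition ordered_clique (n : nat) (G : ordered_graph n) (M k : nat)
    (lab : 'I_n -> 'I_M) (s : 'S_k) (A : 'I_k -> {set 'I_n}) : Prop :=
  clique (cut G lab) lab A /\
  forall i j, (s i < s j)%N -> forall u v : 'I_n, u \in A i -> v \in A j -> (u < v)%N.

(** A perfect tiling of the blow-up is transported along an increasing bijection onto the union of
    the parts, which maps edges to edges since these join different parts. *)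
Lemma blowup_tileable (b k : nat) (B : sgraph 'I_b) (U : 'I_b -> 'I_k)
    (s : 'S_k) (phi : 'S_b) (t : nat) :
  complete_partite B U -> interval_labelling U s phi ->
  has_perfect_tiling H (blowup B phi t) ->
  forall (n : nat) (G : ordered_graph n) (M : nat) (lab : 'I_n -> 'I_M),
  tileable (ordered_clique G lab s) (htiled H G)
    (fun i => t * #|[set x | U x == i]|)%N.
Proof.
move=> [_ adjU] labP [T [[eT dT] cT]] n G M lab A [[_ jA] ordA] cA.
pose c (x : 'I_(b * t)) := U ((phi^-1)%g (block x)).
have cAc i : #|A i| = #|[set x | c x == i]|.
  rewrite cA (card_blocks t (fun j => U ((phi^-1)%g j) == i)); congr (_ * _)%N.
  rewrite -(card_imset _ (@perm_inj _ phi)); apply: eq_card => y; rewrite !inE.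
  apply/imsetP/eqP => [[x + ->]|Uy]; first by rewrite inE permK => /eqP.
  by exists ((phi^-1)%g y); rewrite ?permKV // inE Uy.
have [|f [fmono fA fim]] := ranked_embedding cAc.
  move=> x y xy nc; apply: ordA; rewrite -/(c x) -/(c y).
  have bxy : (block x <= block y)%N by rewrite /= leq_div2r // ltnW.
  case: (ltngtP (s (c x)) (s (c y))) => // [lt|e].
    by have := labP _ _ lt; rewrite !permKV ltnNge bxy.
  by move: nc; rewrite (perm_inj (val_inj e)) eqxx.
have finj : injective f.
  move=> x y fxy; apply: val_inj; case: (ltngtP x y) => // /fmono;
  by rewrite fxy ltnn.
pose F (g : {ffun 'I_h -> 'I_(b * t)}) := [ffun i => f (g i)].
exists (F @: T); split; first split.
- move=> _ /imsetP[g gT ->]; have [ginj gmono gadj] := eT g gT.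
  split=> [i j|i j|i j]; rewrite !ffunE.
  + by move/finj/ginj.
  + by move/gmono/fmono.
  + move/gadj; rewrite /= /blowup_adj adjU => nij.
    by have /andP[] := jA _ _ nij _ _ (fA (g i)) (fA (g j)).
- move=> _ _ /imsetP[g gT ->] /imsetP[g' g'T ->] nF.
  have ngg' : g != g' by apply: contraNneq nF => ->.
  have := dT g g' gT g'T ngg'.
  rewrite !disjoint_subset => /subsetP dgg'; apply/subsetP => x /codomP[i ->].
  rewrite inE; apply/codomP => -[j]; rewrite !ffunE => /finj eij.
  by have := dgg' (g i) (codom_f _ _); rewrite inE eij codom_f.
- rewrite -fim; apply/setP => v; apply/bigcupP/imsetP.
    move=> [_ /imsetP[g gT ->]]; rewrite inE => /codomP[i ->].
    by exists (g i); rewrite ?inE // ffunE.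
  move=> [x _ ->]; have /bigcupP[g gT] := cT x.
  rewrite inE => /codomP[i ->]; exists (F g); first exact: imset_f.
  by rewrite inE; apply/codomP; exists i; rewrite ffunE.
Qed.

Definition universally_tileable (k : nat) (u : 'I_k -> nat) : Prop :=
  forall (n : nat) (G : ordered_graph n) (M : nat) (lab : 'I_n -> 'I_M),
  (forall x y : 'I_n, (lab x < lab y)%N -> (x < y)%N) ->
  tileable (@clique _ (cut G lab) M lab 'I_k) (htiled H G) u.

(** Each order [s] of the parts has its own blow-up factor [t s]; their product serves for all
    orders. The labels of the parts of a clique determine which order occurs. *)
Lemma bottlegraph_tileable (b k : nat) (B : sgraph 'I_b) (U : 'I_b -> 'I_k) :
  complete_partite B U ->
  (forall (s : 'S_k) (phi : 'S_b), interval_labelling U s phi ->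
     exists t : nat, (0 < t)%N /\ has_perfect_tiling H (blowup B phi t)) ->
  exists T, (0 < T)%N /\
    universally_tileable (fun i => T * #|[set x | U x == i]|)%N.
Proof.
move=> BU bot.
have /fin_all_exists[t tP] (s : 'S_k) : exists t : nat, (0 < t)%N /\
    exists2 phi, interval_labelling U s phi & has_perfect_tiling H (blowup B phi t).
  have [phi phiP] := interval_labelling_exists U s.
  by have [t [t0 tP]] := bot s phi phiP; exists t; split=> //; exists phi.
exists (\prod_s t s)%N; split; first by apply: prodn_gt0 => s; case: (tP s).
move=> n G M lab labP A cA sA.
have A0 i : (0 < #|A i|)%N.
  rewrite sA muln_gt0 prodn_gt0; last by move=> s; case: (tP s).
  have [x Ux] := BU.1 i; apply/card_gt0P; exists x.
  by rewrite inE Ux.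
have /fin_all_exists[w wA] i : exists x, x \in A i by apply/card_gt0P.
have [mA jA] := cA.
have [|s sP] := @perm_of_inj k (fun i => lab (w i)).
  move=> i j eij; apply/eqP; apply: contraTT isT => nij.
  have /andP[_] := jA _ _ nij _ _ (wA i) (wA j).
  by rewrite (val_inj eij) eqxx.
have [t0 [phi phiP perf]] := tP s.
have tA := @blowup_tileable b k B U s phi (t s) BU phiP perf n G M lab.
have := @tileableM _ _ (ordered_clique G lab s) (htiled H G) _ _ (htiled0 H G)
  (@htiledU _ H _ G) (\prod_(s' | s' != s) t s') _ tA.
rewrite (bigD1 s) //= in sA; apply.
- move=> X X' sub [cX oX]; split; first exact: clique_sub sub cX.
  move=> i j sij u v ui vj; apply: (oX i j sij).
    exact: (subsetP (sub i)).
  exact: (subsetP (sub j)).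
- by move=> X i j [cX _]; apply: clique_disjoint cX.
- split=> // i j sij u v ui vj; apply: labP.
  rewrite (mA i u (w i) ui (wA i)) (mA j v (w j) vj (wA j)).
  case: (ltngtP (lab (w i)) (lab (w j))) => // [/sP ji|e].
    by have := ltn_trans sij ji; rewrite ltnn.
  have nij : i != j by apply: contraTneq sij => ->; rewrite ltnn.
  have /andP[_] := jA _ _ nij _ _ (wA i) (wA j).
  by rewrite (val_inj e) eqxx.
- by move=> i; rewrite sA mulnAC mulnA mulnC mulnA.
Qed.

End BottleTiles.

Section Symmetrisation.

Variables (h : nat) (H : ordered_graph h).

Local Notation ut := (universally_tileable H).

Lemma eq_universally_tileable k (u v : 'I_k -> nat) : u =1 v -> ut u -> ut v.
Proof. by move=> uv tu n G M lab labP; apply: eq_tileable uv _; apply: tu. Qed.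

Lemma universally_tileableD k (u v : 'I_k -> nat) :
  ut u -> ut v -> ut (fun i => u i + v i)%N.
Proof.
move=> tu tv n G M lab labP.
apply: tileableD (tu n G M lab labP) (tv n G M lab labP).
- exact: clique_sub.
- exact: clique_disjoint.
- exact: htiledU.
Qed.

Lemma universally_tileable_sum k (J : finType) (P : pred J) (u : J -> 'I_k -> nat) :
  (forall j, P j -> ut (u j)) -> ut (fun i => \sum_(j | P j) u j i)%N.
Proof.
move=> tu n G M lab labP; apply: tileable_sum => [||||j Pj].
- exact: clique_sub.
- exact: clique_disjoint.
- exact: htiled0.
- exact: htiledU.
- exact: tu.
Qed.

Lemma universally_tileableM k (c : nat) (u : 'I_k -> nat) :
  ut u -> ut (fun i => c * u i)%N.
Proof.
move=> tu n G M lab labP; apply: tileableM (tu n G M lab labP).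
- exact: clique_sub.
- exact: clique_disjoint.
- exact: htiled0.
- exact: htiledU.
Qed.

(** This serves both to permute the parts and to insert empty parts. *)
Lemma universally_tileable_reindex k l (g : 'I_k -> 'I_l) (u : 'I_k -> nat)
    (v : 'I_l -> nat) :
  injective g -> (forall i, v (g i) = u i) ->
  (forall j, j \notin codom g -> v j = 0%N) -> ut u -> ut v.
Proof.
move=> ginj vg v0 tu n G M lab labP A [mA jA] sA.
have -> : \bigcup_j A j = \bigcup_i A (g i).
  apply/setP => x; apply/bigcupP/bigcupP => [[j _ xj]|[i _ xi]]; last by exists (g i).
  have [/codomP[i ej]|/v0 vj] := boolP (j \in codom g).
    by exists i => //; rewrite -ej.
  by move: (sA j); rewrite vj => /eqP; rewrite cards_eq0 => /eqP A0; rewrite A0 inE in xj.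
apply: (tu n G M lab labP) => [|i]; last by rewrite sA vg.
by split=> // i j nij; apply: jA; rewrite (inj_eq ginj).
Qed.

(* Averaging over the permutations that fix the smallest part makes all other
   parts equal without changing the critical chromatic number. *)
Lemma universally_tileable_symmetrise r (a : 'I_r.+1 -> nat) (i0 : 'I_r.+1) :
  (0 < r)%N -> (forall i, (a i0 <= a i)%N) -> ut a ->
  exists N m s, [/\ (0 < N)%N, (s <= m)%N, s = (N * a i0)%N,
    (r * m + s)%N = (N * \sum_i a i)%N &
    forall i1 : 'I_r.+1, ut (fun i => if i == i1 then s else m)].
Proof.
move=> r0 amin ta.
pose P := [pred p : 'S_r.+1 | p i0 == i0].
pose u i := (\sum_(p | P p) a (p i))%N.
pose N := #|P|.
have N0 : (0 < N)%N by apply/card_gt0P; exists 1%g; rewrite inE perm1.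
have tu : ut u.
  apply: universally_tileable_sum => p _.
  apply: (universally_tileable_reindex (g := (p^-1)%g) _ _ _ ta).
  - exact: perm_inj.
  - by move=> i; rewrite permKV.
  - by move=> j; case/negP; apply/codomP; exists (p j); rewrite permK.
have u0 : u i0 = (N * a i0)%N.
  by rewrite -sum_nat_const; apply: eq_bigr => p /eqP ->.
have usum : (\sum_i u i = N * \sum_i a i)%N.
  rewrite exchange_big /= -sum_nat_const; apply: eq_bigr => p _.
  by rewrite [RHS](reindex_inj (@perm_inj _ p)).
(* Replacing [p] by [tperm i j * p] exchanges its values at [i] and [j] and leaves its value at [i0]
   unchanged. *)
have ueq i j : i != i0 -> j != i0 -> u i = u j.
  move=> ni nj; rewrite /u (reindex_inj (mulgI (tperm i j))) /=.
  apply: eq_big => p; first by rewrite permM tpermD // eq_sym.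
  by move=> _; rewrite permM tpermL.
pose j0 := lift i0 (Ordinal r0).
have nj0 : j0 != i0 by rewrite eq_sym neq_lift.
have uE i : u i = if i == i0 then u i0 else u j0.
  by have [->//|ni] := eqVneq i i0; apply: ueq.
exists N, (u j0), (u i0); split=> //.
- by apply: leq_sum => p /eqP e; rewrite e.
- rewrite -usum (bigD1 i0) //= addnC; congr (_ + _)%N.
  rewrite (eq_bigr (fun=> u j0)) => [|i ni]; last exact: ueq.
  by rewrite sum_nat_const cardC1 card_ord.
- move=> i1; apply: (universally_tileable_reindex (g := tperm i0 i1) _ _ _ tu).
  + exact: perm_inj.
  + move=> i; rewrite [RHS]uE; have [->|ni] := eqVneq i i0.
      by rewrite tpermL eqxx.
    by rewrite -[X in _ == X](tpermL i0 i1) (inj_eq perm_inj) (negbTE ni).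
  + by move=> j; case/negP; apply/codomP; exists (tperm i0 i1 j); rewrite tpermK.
Qed.

(* If all parts have the same size we add a further part, much smaller than the
   others, so that the neck is always strictly smaller than the other parts. *)
Lemma bottlegraph_bottle (R : realType) (b : nat) (B : sgraph 'I_b) (eps : R) :
  is_bottlegraph H B -> (1 < chi B)%N -> 0 < eps ->
  exists r m s, [/\ (0 < r)%N, (s < m)%N,
    (r * m + s)%:R <= (chi_cr R B + eps) * m%:R &
    forall i0 : 'I_r.+1, ut (fun i => if i == i0 then s else m)].
Proof.
move=> [k [U [BU bot]]]; rewrite (chi_complete_partite BU) => k1 e0.
case: k U BU bot k1 => [//|r] U BU bot; rewrite ltnS => r0.
have [T [T0 tT]] := bottlegraph_tileable BU bot.
pose a i := #|[set x | U x == i]|.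
pose i0 := [arg min_(i < ord0) a i].
have amin i : (a i0 <= a i)%N.
  by rewrite /i0; case: arg_minnP => // j _ jP; apply: jP.
have a0 : (0 < a i0)%N.
  by have [x Ux] := BU.1 i0; apply/card_gt0P; exists x; rewrite inE Ux.
have sB : sigma B = a i0 by apply: (sigma_complete_partite BU).
have bE : (\sum_i a i = b)%N.
  rewrite -[RHS]card_ord -sum1_card (partition_big U predT) //=.
  by apply: eq_bigr => i _; rewrite sum1dep_card.
have [|N [m [s [N0 sm sE tot tms]]]] := universally_tileable_symmetrise r0 _ tT (i0 := i0).
  by move=> i; rewrite leq_mul2l amin orbT.
rewrite -big_distrr /= bE in tot.
have s0 : (0 < s)%N by rewrite sE !muln_gt0 N0 T0.
have chiB : chi_cr R B * m%:R = (r * m + s)%:R.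
  rewrite /chi_cr (chi_complete_partite BU) sB card_ord -natr1 addrK tot.
  have rm : r%:R * m%:R = (N * T)%:R * (b%:R - (a i0)%:R) :> R.
    rewrite mulrBr -!natrM -mulnA -tot (_ : (N * T * a i0 = s)%N).
      by rewrite natrD addrK.
    by rewrite sE mulnA.
  have m0 : (0 < m)%N := leq_trans s0 sm.
  have nz : b%:R - (a i0)%:R != 0 :> R.
    apply: contraTneq isT => nz; move: rm; rewrite nz mulr0 -natrM => /eqP.
    by rewrite pnatr_eq0 muln_eq0 -!leqn0 leqNgt r0 leqNgt m0.
  rewrite [LHS](_ : _ = r%:R * m%:R / (b%:R - (a i0)%:R) * b%:R); last by ring.
  by rewrite rm mulfK // !natrM mulrA.
have m0 : (0 < m)%N := leq_trans s0 sm.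
move: sm; rewrite leq_eqVlt => /predU1P[sm|sm]; last first.
  exists r, m, s; split=> //; rewrite mulrDl chiB lerDl mulr_ge0 //.
  exact: ltW.
(* Here [m = s] and the critical chromatic number is [r.+1]. The new neck has size [r.+1 * m], at
   most [eps * m'] because [w >= r.+1 / eps]; [w >= 2] makes it smaller than [m']. *)
have [v vP] := exists_natr_gt (r.+1%:R / eps).
pose w := maxn v 2; pose m' := ((r + w) * m)%N; pose s' := (r.+1 * m)%N.
have w2 : (2 <= w)%N by apply: leq_maxr.
exists r.+1, m', s'; split=> //.
- by rewrite /m' /s' ltn_mul2r m0 -addn1 ltn_add2l.
- have -> : chi_cr R B = r.+1%:R.
    apply: (@mulIf _ m%:R); first by rewrite pnatr_eq0 -lt0n.
    by rewrite chiB sm -natrM mulSn addnC.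
  have vw : r.+1%:R <= eps * w%:R.
    move: vP; rewrite ltr_pdivrMr // => /ltW/le_trans; apply.
    by rewrite mulrC ler_pM2l // ler_nat leq_maxl.
  rewrite /s' natrD natrM mulrDl lerD2l /m' !natrM mulrA ler_wpM2r //.
  apply: le_trans vw _; rewrite ler_pM2l // ler_nat leq_addl //.
move=> i1.
have tm : ut (fun _ : 'I_r.+1 => m).
  by apply: eq_universally_tileable (tms ord0) => i; rewrite sm if_same.
have tl (i : 'I_r.+2) : ut (fun j => if j == i then 0 else m)%N.
  apply: (universally_tileable_reindex (g := lift i) _ _ _ tm).
  - exact: lift_inj.
  - by move=> j; rewrite eq_sym (negbTE (neq_lift i j)).
  - move=> j; case: eqP => // /eqP; rewrite eq_sym => nj.
    by case/negP; have [l -> _] := unlift_some nj; apply: codom_f.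
(* With [tl j] omitting part [j], one copy for each [j != i1] and [w] copies for [i1] add up to
   [r.+1 * m] at [i1] and [(r + w) * m] elsewhere. *)
have := universally_tileableD (universally_tileable_sum (P := predC1 i1) (fun j _ => tl j))
  (universally_tileableM (c := w) (tl i1)).
apply: eq_universally_tileable => i.
case: eqP => [->|/eqP ni].
  rewrite muln0 addn0 (eq_bigr (fun=> m)) => [|j nj]; last by rewrite eq_sym (negbTE nj).
  by rewrite sum_nat_const cardC1 card_ord.
rewrite (bigD1 i) //= eqxx add0n /m' mulnDl; congr (_ + _)%N.
rewrite (eq_bigr (fun=> m)) => [|j /andP[_ nj]]; last by rewrite eq_sym (negbTE nj).
rewrite sum_nat_const; congr (_ * _)%N.
have := cardC1 i1; rewrite card_ord /= (cardD1 i) inE ni add1n => -[cr].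
rewrite -[RHS]cr.
by apply: eq_card => j; rewrite !inE andbC.
Qed.

End Symmetrisation.

(** * Perfect tilings of blow-ups *)

Section Farkas.

Variables (F : realFieldType) (X : finType).
Implicit Types (a c g x : {ffun X -> F}) (S : seq {ffun X -> F}).

Definition dot a x : F := \sum_i a i * x i.

Definition axpy g (l : F) a : {ffun X -> F} := [ffun i => g i + l * a i].

Fixpoint cone S g : Prop :=
  if S is a :: S' then exists2 l, 0 <= l & cone S' (axpy g (- l) a)
  else g = [ffun=> 0].

Lemma dot_axpyl g l a x : dot (axpy g l a) x = dot g x + l * dot a x.
Proof.
rewrite /dot mulr_sumr -big_split; apply: eq_bigr => i _ /=.
by rewrite ffunE mulrDl mulrA.
Qed.

Lemma dot_axpyr g l a x : dot x (axpy g l a) = dot x g + l * dot x a.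
Proof.
rewrite /dot mulr_sumr -big_split; apply: eq_bigr => i _ /=.
by rewrite ffunE mulrDr mulrCA.
Qed.

(** The multiples of [a] contributed by the sheared generators add up to one nonnegative
    multiple. *)
Lemma cone_shear S g a (w : {ffun X -> F} -> F) :
  (forall c, c \in S -> 0 <= w c) ->
  cone [seq axpy c (w c) a | c <- S] g ->
  exists2 l, 0 <= l & cone S (axpy g (- l) a).
Proof.
elim: S g => [|c S IH] g w0 /=.
  move=> ->; exists 0 => //; apply/ffunP => i; rewrite !ffunE; ring.
move=> [l l0 /IH[|l' l'0 cS]].
  by move=> d dS; apply: w0; rewrite inE dS orbT.
have wc : 0 <= w c by apply: w0; rewrite inE eqxx.
exists (l' + l * w c); first by rewrite addr_ge0 ?mulr_ge0.
exists l => //; congr cone: cS; apply/ffunP => i; rewrite !ffunE; ring.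
Qed.

(* Bartl's induction on the number of generators: a point x0 showing that g is
   not in the cone of S is used to project along a. *)
Lemma farkas S g :
  (forall x, (forall a, a \in S -> 0 <= dot a x) -> 0 <= dot g x) -> cone S g.
Proof.
have [n] := ubnP (size S); elim: n S g => // n IH [|a S] g /=.
  move=> _ gP; have := gP [ffun i => - g i] (fun a => ltac:(by [])).
  have -> : dot g [ffun i => - g i] = - \sum_i g i ^+ 2.
    by rewrite -sumrN; apply: eq_bigr => i _; rewrite ffunE mulrN expr2.
  rewrite oppr_ge0 => le0; apply/ffunP => i; rewrite ffunE.
  have : \sum_i g i ^+ 2 == 0.
    by rewrite eq_le le0 sumr_ge0 // => j _; apply: sqr_ge0.
  rewrite psumr_eq0 => [/allP/(_ i)|j _]; last exact: sqr_ge0.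
  by rewrite mem_index_enum sqrf_eq0 => /(_ isT)/eqP.
(* If no such [x0] exists, [g] is already in the cone of [S], with coefficient 0 at [a]. *)
rewrite ltnS => ltS gP; have [[x0 [x0S gx0]]|no] := boolp.pselect
    (exists x0, (forall c, c \in S -> 0 <= dot c x0) /\ dot g x0 < 0); last first.
  exists 0 => //; have -> : axpy g (- 0) a = g.
    by apply/ffunP => i; rewrite ffunE; ring.
  apply: IH ltS _ => x xS; rewrite leNgt; apply/negP => gx.
  by apply: no; exists x.
pose al := - dot a x0.
have al0 : 0 < al.
  rewrite oppr_gt0 ltNge; apply/negP => ax0.
  have := gP x0; rewrite leNgt gx0 => /(_ _)/negP; apply=> // c.
  by rewrite inE => /predU1P[->|/x0S].
have aln : al != 0 by rewrite gt_eqF.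
(* With this weight [axpy c (w c) a] is orthogonal to [x0]. *)
pose w c := dot c x0 / al.
have [||l l0 cl] := @cone_shear S (axpy g (w g) a) a w.
- by move=> c cS; rewrite divr_ge0 ?x0S // ltW.
- apply: IH => [|x xS]; first by rewrite size_map.
  (* [y] is the translate of [x] along [x0] that is orthogonal to [a], so the hypothesis on [g] can
     be applied to it. *)
  pose y := axpy x (dot a x / al) x0.
  have yE c : dot (axpy c (w c) a) x = dot c y.
    by rewrite dot_axpyl dot_axpyr /w; ring.
  rewrite yE; apply: gP => c; rewrite inE => /predU1P[->|cS].
    rewrite dot_axpyr -[dot a x0]opprK -/al mulrN divfK //.
    by rewrite subrr.
  by rewrite -yE; apply: xS; apply: map_f.
exists (l - w g).
  by rewrite subr_ge0 (le_trans _ l0) // ltW // pmulr_llt0 ?invr_gt0.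
by congr cone: cl; apply/ffunP => i; rewrite !ffunE; ring.
Qed.

End Farkas.

(** Farkas' lemma is applied over the rationals so that coefficients can be cleared to whole numbers
    of copies. *)
Lemma ge0_ratE (l : rat) : 0 <= l ->
  exists p q : nat, (0 < q)%N /\ l * q%:R = p%:R.
Proof.
move=> l0; exists `|numq l|%N, `|denq l|%N; split; first by rewrite absz_gt0 denq_neq0.
have num0 : 0 <= numq l by rewrite numq_ge0.
rewrite !pmulrn !gez0_abs ?denq_ge0 //.
by rewrite -[X in X * _]divq_num_den divfK // intr_eq0 denq_neq0.
Qed.

Section PerfectBlowups.

Variables (h b : nat) (H : ordered_graph h) (B : sgraph 'I_b) (phi : 'S_b).
Implicit Types tau : {ffun 'I_h -> 'I_b}.

(** These are the ways in which a copy of [H] can be distributed over the blocks; several vertices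
    may share a block, hence the weak monotonicity. *)
Definition block_type tau : bool :=
  [forall i : 'I_h, forall j : 'I_h, (i < j)%N ==> (tau i <= tau j)%N] &&
  [forall i, forall j, H i j ==> B ((phi^-1)%g (tau i)) ((phi^-1)%g (tau j))].

Definition block_count tau (x : 'I_b) : nat := #|[set i | tau i == x]|.

Definition in_blocks (t : nat) (A : 'I_b -> {set 'I_(b * t)}) : Prop :=
  forall x v, v \in A x -> block v = x.

Lemma in_blocks_sub t (A A' : 'I_b -> {set 'I_(b * t)}) :
  (forall x, A' x \subset A x) -> in_blocks A -> in_blocks A'.
Proof. by move=> sub bA x v vx; apply: bA; apply: (subsetP (sub x)). Qed.

Lemma in_blocks_disjoint t (A : 'I_b -> {set 'I_(b * t)}) x y :
  in_blocks A -> x != y -> [disjoint A x & A y].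
Proof.
move=> bA nxy; rewrite disjoints_subset; apply/subsetP => v vx; rewrite inE.
by apply: contra nxy => vy; rewrite -(bA _ _ vx) (bA _ _ vy).
Qed.

Definition blocks_tileable (u : 'I_b -> nat) : Prop :=
  forall t, tileable (@in_blocks t) (htiled H (blowup B phi t)) u.

Lemma block_type_tileable tau : block_type tau -> blocks_tileable (block_count tau).
Proof.
move=> /andP[/forallP mtau /forallP atau] t A bA cA.
have [|f [fmono fA fim]] := ranked_embedding cA.
  move=> i j ij nij u v ui vj.
  have lt : (block u < block v)%N.
    rewrite (bA _ _ ui) (bA _ _ vj) ltn_neqAle -(inj_eq val_inj) in nij *.
    by rewrite nij; move/forallP: (mtau i) => /(_ j)/implyP; apply.
  by rewrite ltnNge; apply: contraL lt => vu; rewrite -leqNgt /= leq_div2r.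
exists [set finfun f]; split; last first.
  rewrite /covered big_set1 -fim; apply/setP => v; rewrite inE.
  apply/codomP/imsetP => [[i ->]|[i _ ->]]; first by exists i; rewrite ?ffunE.
  by exists i; rewrite ffunE.
split=> [g|g g']; last first.
  by rewrite !inE => /eqP-> /eqP->; rewrite eqxx.
rewrite inE => /eqP->; split=> [i j|i j|i j]; rewrite !ffunE.
- move=> fij; apply: val_inj; case: (ltngtP i j) => // /fmono;
  by rewrite fij ltnn.
- exact: fmono.
- move=> Hij; rewrite /= /blowup_adj (bA _ _ (fA i)) (bA _ _ (fA j)).
  by move/forallP: (atau i) => /(_ j)/implyP; apply.
Qed.

Definition count_vector tau : {ffun 'I_b -> rat} :=
  [ffun x => (block_count tau x)%:R].

Lemma dot_count_vector tau (x : {ffun 'I_b -> rat}) :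
  dot (count_vector tau) x = \sum_i x (tau i).
Proof.
rewrite (partition_big tau predT) //=; apply: eq_bigr => j _.
rewrite ffunE (eq_bigr (fun=> x j)) => [|i /eqP-> //].
rewrite sumr_const mulr_natl; congr (_ *+ _).
by apply: eq_card => i; rewrite !inE.
Qed.

Lemma cone_blocks_tileable (s : seq {ffun 'I_h -> 'I_b}) (g : {ffun 'I_b -> rat}) :
  all block_type s -> cone [seq count_vector tau | tau <- s] g ->
  exists D u, [/\ (0 < D)%N, blocks_tileable u & forall x, (u x)%:R = D%:R * g x].
Proof.
elim: s g => [|tau s IH] g /=.
  move=> _ ->; exists 1%N, (fun=> 0%N); split=> // [t|x]; last by rewrite ffunE mulr0.
  by apply: tileable0; apply: htiled0.
move=> /andP[ttau ts] [l l0 /(IH _ ts)[D [u [D0 tu uE]]]].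
have [p [q [q0 lpq]]] := ge0_ratE l0.
exists (q * D)%N, (fun x => q * u x + (D * p) * block_count tau x)%N; split.
- by rewrite muln_gt0 q0.
- move=> t; apply: tileableD; [exact: in_blocks_sub|exact: in_blocks_disjoint|exact: htiledU| |].
    apply: tileableM (tu t); [exact: in_blocks_sub|exact: in_blocks_disjoint|exact: htiled0|exact: htiledU].
  apply: tileableM (block_type_tileable ttau (t := t));
  [exact: in_blocks_sub|exact: in_blocks_disjoint|exact: htiled0|exact: htiledU].
- move=> x; rewrite natrD !natrM uE !ffunE -lpq; ring.
Qed.

Lemma sum_block (t : nat) (x : {ffun 'I_b -> rat}) :
  \sum_(v : 'I_(b * t)) x (block v) = t%:R * \sum_j x j.
Proof.
rewrite (partition_big (@block b t) predT) //= mulr_sumr; apply: eq_bigr => j _.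
rewrite (eq_bigr (fun=> x j)) => [|i /eqP-> //].
rewrite sumr_const mulr_natl; congr (_ *+ _).
by rewrite -[RHS](card_block t j); apply: eq_card => i; rewrite !inE.
Qed.

(** The weight of the covered set is the sum of the weights of its copies, each of which has a block
    type. *)
Lemma tiling_weight_ge0 (t : nat) (T : {set {ffun 'I_h -> 'I_(b * t)}})
    (x : {ffun 'I_b -> rat}) :
  is_tiling H (blowup B phi t) T ->
  (forall tau, block_type tau -> 0 <= dot (count_vector tau) x) ->
  0 <= \sum_(v in covered T) x (block v).
Proof.
move=> [eT dT] x0.
pose F (f : {ffun 'I_h -> 'I_(b * t)}) := if f \in T then [set v in codom f] else set0.
have -> : covered T = \bigcup_f F f by rewrite /covered big_mkcond.
rewrite partition_disjoint_bigcup => [|f g nfg]; last first.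
  rewrite /F; case: ifP => fT; last by rewrite -setI_eq0 set0I.
  case: ifP => gT; last by rewrite -setI_eq0 setI0.
  have := dT f g fT gT nfg; rewrite !disjoint_subset => /subsetP dfg.
  by apply/subsetP => v; rewrite !inE => /dfg.
apply: sumr_ge0 => f _; rewrite /F; case: ifP => fT; last by rewrite big_set0.
have [finj fmono fadj] := eT f fT.
have -> : \sum_(v in [set v in codom f]) x (block v) =
    dot (count_vector [ffun i => block (f i)]) x.
  rewrite dot_count_vector.
  have -> : [set v in codom f] = f @: [set: 'I_h].
    apply/setP => v; rewrite inE; apply/codomP/imsetP => [[i ->]|[i _ ->]].
      by exists i.
    by exists i.
  rewrite big_imset /=; last by move=> i j _ _; apply: finj.
  by apply: eq_big => [i|i _]; rewrite ?inE ?ffunE.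
apply: x0; apply/andP; split; apply/forallP => i; apply/forallP => j; apply/implyP.
  by rewrite !ffunE => /fmono/ltnW; apply: leq_div2r.
by rewrite !ffunE => /fadj.
Qed.

Lemma perfect_of_almost_perfect :
  (forall N : nat, exists t, (0 < t)%N /\ exists T : {set {ffun 'I_h -> 'I_(b * t)}},
     is_tiling H (blowup B phi t) T /\ (N * #|~: covered T| <= b * t)%N) ->
  exists t, (0 < t)%N /\ has_perfect_tiling H (blowup B phi t).
Proof.
move=> almost.
have : cone [seq count_vector tau | tau <- enum block_type] [ffun=> 1].
  apply: farkas => x xP.
  have {}xP tau : block_type tau -> 0 <= dot (count_vector tau) x.
    by move=> ttau; apply: xP; apply: map_f; rewrite mem_enum.
  have -> : dot [ffun=> 1] x = \sum_j x j.
    by apply: eq_bigr => j _; rewrite ffunE mul1r.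
  (* A separating [x] gives the whole blow-up weight [t] times a negative constant, while covered
     vertices weigh at least 0 in total. As each vertex weighs at least [- c], a fixed proportion
     stays uncovered, which fails for large [N]. *)
  rewrite leNgt; apply/negP => neg; pose c := \sum_j `|x j|.
  have xc j : - c <= x j.
    rewrite lerNl (le_trans (ler_norm _)) // normrN /c (bigD1 j) //= lerDl.
    exact: sumr_ge0.
  have [N ltN] := exists_natr_gt (b%:R * c / - \sum_j x j).
  have [t [t0 [T [tT uT]]]] := almost N.
  have wT := tiling_weight_ge0 tT xP.
  have wU : - (#|~: covered T|%:R * c) <= \sum_(v in ~: covered T) x (block v).
    rewrite mulr_natl -mulNrn -sumr_const; apply: ler_sum => v _; exact: xc.
  have := sum_block t x; rewrite (bigID (mem (covered T))) /=.
  have -> : \sum_(v | v \notin covered T) x (block v) =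
      \sum_(v in ~: covered T) x (block v).
    by apply: eq_bigl => v; rewrite inE.
  move=> eqS; have {}eqS : - (#|~: covered T|%:R * c) <= t%:R * \sum_j x j.
    by rewrite -eqS (le_trans wU) // lerDr.
  have c0 : 0 <= c by apply: sumr_ge0.
  have h1 : (N%:R * #|~: covered T|%:R) * c <= (b%:R * t%:R) * c.
    by rewrite ler_wpM2r // -!natrM ler_nat.
  have t0' : 0 < t%:R :> rat by rewrite ltr0n.
  move: ltN; rewrite ltr_pdivrMr ?oppr_gt0 // -(ltr_pM2r t0').
  have h2 : N%:R * - (#|~: covered T|%:R * c) <= N%:R * (t%:R * \sum_j x j).
    by rewrite ler_wpM2l.
  lra.
move=> /cone_blocks_tileable[|D [u [D0 tu uE]]].
  by apply/allP => tau; rewrite mem_enum.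
(* The vector [u] is constantly [D], the size of every block for this blow-up factor. *)
exists D; split=> //.
have [|v|T [tT cT]] := tu D (fun j => [set v | block v == j]).
- by move=> j v; rewrite inE => /eqP.
- rewrite card_block; apply/eqP; rewrite -(eqr_nat rat) uE ffunE mulr1.
  exact: eqxx.
exists T; split=> // v; rewrite cT; apply/bigcupP; exists (block v) => //.
by rewrite inE.
Qed.

End PerfectBlowups.

Lemma mindegree_le (V : finType) (G : sgraph V) (x : V) :
  (mindegree G <= degree G x)%N.
Proof. exact: bigminn_le. Qed.

(** The bound by [#|V|] handles the default value in [mindegree]. *)
Lemma le_mindegree (R : realType) (V : finType) (G : sgraph V) (d : R) :
  d <= #|V|%:R -> (forall x, d <= (degree G x)%:R) -> d <= (mindegree G)%:R.
Proof.
move=> dV dG; rewrite /mindegree; apply: (big_ind (fun k => d <= k%:R)) => //.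
by move=> k l dk dl; rewrite /minn; case: ifP.
Qed.

(** * Complete multipartite graphs with parts of size [m] and one remainder *)

Section BottleGraph.

Variables (b m : nat).

Definition bottle_adj : rel 'I_b := fun x y => (x %/ m != y %/ m)%N.

Lemma bottle_sym : symmetric bottle_adj.
Proof. by move=> x y; rewrite /bottle_adj eq_sym. Qed.

Lemma bottle_irr : irreflexive bottle_adj.
Proof. by move=> x; rewrite /bottle_adj eqxx. Qed.

Definition bottle : sgraph 'I_b := SGraph bottle_sym bottle_irr.

(** For positive [b] and [m] the number of parts is [b / m] rounded up; the last one is nonempty and
    may be full. *)
Definition bottle_part (x : 'I_b) : 'I_(b.-1 %/ m).+1 := inord (x %/ m).

Hypotheses (m0 : (0 < m)%N) (mb : (m < b)%N).

Lemma val_bottle_part x : bottle_part x = (x %/ m)%N :> nat.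
Proof.
rewrite inordK // ltnS leq_div2r // -ltnS prednK ?ltn_ord //.
exact: leq_trans mb.
Qed.

Lemma bottle_complete_partite : complete_partite bottle bottle_part.
Proof.
have b0 : (0 < b)%N by apply: leq_trans mb.
split=> [i|x y]; last by rewrite -val_eqE /= !val_bottle_part.
have lt : (i * m < b)%N.
  apply: (@leq_ltn_trans b.-1); last by rewrite ltn_predL.
  apply: leq_trans (leq_divM b.-1 m).
  by rewrite leq_mul2r -ltnS ltn_ord orbT.
by exists (Ordinal lt); apply: val_inj; rewrite /= val_bottle_part /= mulnK.
Qed.

Lemma card_bottle_part_le (q : nat) : (#|[set x : 'I_b | x %/ m == q]| <= m)%N.
Proof.
pose f (x : 'I_b) : 'I_m := Ordinal (ltn_pmod x m0).
rewrite -(@card_in_imset _ _ f).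
  by rewrite (leq_trans (max_card _)) // card_ord.
move=> x y; rewrite !inE => /eqP ex /eqP ey [exy]; apply: val_inj => /=.
by rewrite (divn_eq x m) (divn_eq y m) ex ey exy.
Qed.

(** With [k] parts before the last one, the smallest part has at most [b - k * m] vertices, so the
    denominator in [chi_cr] is at least [k * m]. *)
Lemma chi_cr_bottle (R : realType) :
  [/\ (1 < chi bottle)%N, 0 <= chi_cr R bottle & chi_cr R bottle * m%:R <= b%:R].
Proof.
have BU := bottle_complete_partite.
have b0 : (0 < b)%N by apply: leq_trans mb.
have k1 : (0 < b.-1 %/ m)%N.
  by rewrite divn_gt0 // -ltnS prednK.
rewrite /chi_cr (chi_complete_partite BU) card_ord -natr1 addrK.
pose a i := #|[set x | bottle_part x == i]|.
pose i0 := [arg min_(i < ord0) a i].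
have amin i : (a i0 <= a i)%N.
  by rewrite /i0; case: arg_minnP => // j _ jP; apply: jP.
rewrite (sigma_complete_partite BU (i0 := i0)) // -/(a i0).
pose k := (b.-1 %/ m)%N.
have kmb : (k * m <= b)%N.
  by apply: leq_trans (leq_divM _ _) _; apply: leq_pred.
have last_part : (a ord_max + k * m <= b)%N.
  pose S := [set x : 'I_b | (x < k * m)%N].
  have cS : (k * m <= #|S|)%N.
    pose f (x : 'I_(k * m)) : 'I_b := widen_ord kmb x.
    have finj : injective f by move=> x y [] /val_inj.
    rewrite -[leqLHS]card_ord -cardsT -(card_imset _ finj) subset_leq_card //.
    by apply/subsetP => _ /imsetP[x _ ->]; rewrite inE /=.
  apply: (@leq_trans (a ord_max + #|S|)); first by rewrite leq_add2l.
  rewrite /a -cardsUI (_ : _ :&: S = set0) ?cards0 ?addn0.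
    by rewrite (leq_trans (max_card _)) // card_ord.
  apply/setP => x; rewrite !inE -val_eqE /= val_bottle_part.
  by case: eqP => //= ex; apply/negbTE; rewrite -leqNgt /k -ex leq_divM.
have le0 : (a i0 + k * m <= b)%N by apply: leq_trans last_part; rewrite leq_add2r.
have D0 : 0 < b%:R - (a i0)%:R :> R.
  rewrite subr_gt0 ltr_nat; apply: leq_trans le0.
  by rewrite -addn1 leq_add2l muln_gt0 k1.
split=> //; first by rewrite divr_ge0 ?mulr_ge0 // ltW.
rewrite mulrAC ler_pdivrMr // mulrAC mulrC ler_wpM2l //.
by rewrite lerBrDl -natrM -natrD ler_nat.
Qed.

Lemma degree_bottle_blowup (phi : 'S_b) (t : nat) (v : 'I_(b * t)) :
  ((b - m) * t <= degree (blowup bottle phi t) v)%N.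
Proof.
pose q := ((phi^-1)%g (block v) %/ m)%N.
pose P (j : 'I_b) := ((phi^-1)%g j %/ m == q)%N.
have cP : (#|[set j | P j]| <= m)%N.
  apply: leq_trans (card_bottle_part_le q).
  rewrite -(card_imset _ (@perm_inj _ phi^-1)) subset_leq_card //.
  by apply/subsetP => _ /imsetP[j + ->]; rewrite !inE.
have -> : degree (blowup bottle phi t) v = #|~: [set w : 'I_(b * t) | P (block w)]|.
  rewrite /degree; apply: eq_card => w; rewrite !inE /= /blowup_adj /= /bottle_adj.
  by rewrite /P eq_sym.
rewrite cardsCs setCK card_ord card_blocks mulnBl leq_sub2l //.
by rewrite mulnC leq_mul2r cP orbT.
Qed.

End BottleGraph.

Lemma bottlegraph_of_forces (R : realType) (h : nat) (H : ordered_graph h)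
    (c eps : R) :
  0 <= c -> c < 1 -> forces_almost_tiling H c -> 0 < eps ->
  exists (b : nat) (B : sgraph 'I_b),
    [/\ is_bottlegraph H B, (1 < chi B)%N & chi_cr R B * (1 - c - eps) <= 1].
Proof.
move=> c0 c1 forceH e0.
have [e [e0' ee ec]] : exists e : R, [/\ 0 < e, e <= eps & e <= 1 - c].
  exists (Num.min eps (1 - c)); rewrite lt_min e0 subr_gt0 c1.
  by rewrite ge_min lexx ge_min lexx orbT.
(* With [m] the integer part of [y * b], the ratio [m / b] is at most [1 - c], as the degree
   condition requires, and at least [1 - c - e] once [e * b >= 2]. *)
pose y := 1 - c - e / 2.
have y0 : 0 < y by rewrite /y; lra.
have y1 : y < 1 by rewrite /y; lra.
have [b1 b1P] := exists_natr_gt y^-1.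
have [b2 b2P] := exists_natr_gt (2 / e).
pose b := maxn b1 b2.
have yb : 1 <= y * b%:R.
  move: b1P; rewrite -div1r ltr_pdivrMr // => /ltW/le_trans; apply.
  by rewrite mulrC ler_pM2l // ler_nat leq_maxl.
have eb : 2 <= e * b%:R.
  move: b2P; rewrite ltr_pdivrMr // => /ltW/le_trans; apply.
  by rewrite mulrC ler_pM2l // ler_nat leq_maxr.
have b0' : 0 < b%:R :> R by rewrite -(pmulr_rgt0 _ y0) (lt_le_trans _ yb).
pose m := Num.truncn (y * b%:R).
have yb0 : 0 <= y * b%:R by apply: le_trans yb.
have mle : m%:R <= y * b%:R by rewrite truncn_le.
have mgt : y * b%:R < m%:R + 1 by rewrite natr1 truncnS_gt.
have m0 : (0 < m)%N by rewrite -(ltr_nat R); lra.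
have mb : (m < b)%N.
  rewrite -(ltr_nat R) (le_lt_trans mle) // -[ltRHS]mul1r ltr_pM2r //.
have [k1 chi0 chim] := chi_cr_bottle m0 mb R.
exists b, (bottle b m); split=> //; last first.
  have : 1 - c - eps <= m%:R / b%:R.
    rewrite ler_pdivlMr // /y in mgt *.
    have : (1 - c - eps) * b%:R <= (1 - c - e) * b%:R.
      by rewrite ler_wpM2r // lerB.
    lra.
  move=> /(ler_wpM2l chi0)/le_trans; apply.
  by rewrite mulrA ler_pdivrMr // mul1r.
exists (b.-1 %/ m).+1, (@bottle_part b m); split.
  exact: bottle_complete_partite.
move=> s phi _; apply: perfect_of_almost_perfect => N.
have [|n0 n0P] := forceH (N.+1%:R^-1); first by rewrite invr_gt0.
have b0 : (0 < b)%N by rewrite -(ltr_nat R).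
exists n0.+1; split=> //.
have [||T [tT uT]] := n0P (b * n0.+1)%N (blowup (bottle b m) phi n0.+1).
- by rewrite (leq_trans (leqnSn n0)) // leq_pmull.
- apply: (@le_trans _ _ ((b - m) * n0.+1)%:R).
    rewrite !natrM mulrA ler_wpM2r // natrB; last exact: ltnW.
    rewrite lerBrDl -lerBrDr (le_trans mle) // /y.
    have : 0 <= e * b%:R by rewrite mulr_ge0 // ltW.
    lra.
  apply: le_mindegree => [|v]; rewrite ler_nat.
    by rewrite card_ord leq_mul2r leq_subr orbT.
  exact: degree_bottle_blowup.
exists T; split=> //.
move: uT; rewrite mulrC ler_pdivlMr // -natrM ler_nat mulnC.
by apply: leq_trans; rewrite leq_mul2r leqnSn orbT.
Qed.

(** * The threshold *)

Lemma forces_of_bottle (R : realType) (h : nat) (H : ordered_graph h)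
    (r m s : nat) (d c : R) :
  (0 < r)%N -> (s < m)%N ->
  (forall i0 : 'I_r.+1, universally_tileable H (fun i => if i == i0 then s else m)) ->
  d * (r * m + s)%:R = (r.-1 * m + s)%:R -> d < c ->
  forces_almost_tiling H c.
Proof.
move=> r0 sm tms db dc eta eta0.
(* Of the [7 * eps], cutting into intervals costs [2 * eps]; [almost_tiling] uses the remaining
   [5 * eps]. *)
have [eps [e0 e1 ec]] : exists eps : R, [/\ 0 < eps, eps <= 1 & d + 7 * eps <= c].
  exists (Num.min 1 ((c - d) / 7)); rewrite lt_min ltr01 ge_min lexx.
  rewrite divr_gt0 ?subr_gt0 //; split=> //.
  have : Num.min 1 ((c - d) / 7) <= (c - d) / 7 by rewrite ge_min lexx orbT.
  lra.
have [M MP] := exists_natr_gt eps^-1.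
have M1 : 1 <= eps * M%:R.
  by move: MP; rewrite -div1r ltr_pdivrMr // => /ltW; rewrite mulrC.
have M0 : (0 < M)%N.
  rewrite lt0n; apply: contraTneq M1 => ->.
  by rewrite mulr0 -ltNge ltr01.
have [N0 N0P] := almost_tiling M r0 sm e0 e1 eta0 db.
exists (maxn N0 M) => n G; rewrite geq_max => /andP[leN0 leM] degG.
pose l := (n %/ M).+1.
have labM (x : 'I_n) : (x %/ l < M)%N.
  by rewrite ltn_divLR // (ltn_trans (ltn_ord x)) // mulnC ltn_ceil.
pose lab (x : 'I_n) := Ordinal (labM x).
have labP (x y : 'I_n) : (lab x < lab y)%N -> (x < y)%N.
  by rewrite /= !ltnNge; apply: contra => yx; apply: leq_div2r.
have ln : l%:R <= 2 * eps * n%:R.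
  have h1 : (n %/ M)%:R * M%:R <= n%:R :> R by rewrite -natrM ler_nat leq_divM.
  have h2 : M%:R <= n%:R :> R by rewrite ler_nat.
  have h3 : (n %/ M)%:R * 1 <= (n %/ M)%:R * (eps * M%:R) by rewrite ler_wpM2l.
  have h4 : eps * ((n %/ M)%:R * M%:R) <= eps * n%:R by rewrite ler_wpM2l // ltW.
  have h5 : eps * M%:R <= eps * n%:R by rewrite ler_wpM2l // ltW.
  rewrite /l -natr1; lra.
have [||X [tX cX]] := N0P _ (cut G lab) lab; first by rewrite card_ord.
  move=> x; rewrite card_ord.
  have degx : (degree G x <= degree (cut G lab) x + l)%N.
    apply: leq_trans (leq_add (leqnn _) (@card_bottle_part_le n l (ltn0Sn _) (x %/ l)%N)).
    apply: leq_trans (leq_card_setU _ _); apply: subset_leq_card.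
    apply/subsetP => y; rewrite !inE /= /cut_adj => -> /=.
    by rewrite -val_eqE /= orbC eq_sym orbN.
  have : c * n%:R <= (degree G x)%:R.
    by apply: le_trans degG _; rewrite ler_nat mindegree_le.
  move: degx; rewrite -(ler_nat R) natrD => h1 h2.
  have h3 : (d + 7 * eps) * n%:R <= c * n%:R by rewrite ler_wpM2r.
  lra.
(* At scale 1 each tile has exactly the part sizes for which [tms] gives a perfect tiling. *)
have [T [tT cT]] : htiled H G X.
  elim: tX => [|A Y [cA [i0 sA]] _ IH dAY]; first exact: htiled0.
  apply: htiledU => //; apply: (tms i0) cA _ => // i.
  by rewrite sA mul1n.
exists T; split=> //; rewrite cT.
have := cardsC X; rewrite card_ord => /(congr1 (fun k => k%:R : R)).
rewrite natrD => h1; move: cX; rewrite card_ord; lra.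
Qed.

(** * Adding dominating vertices *)

Section Dominate.

Variables (n a : nat) (G : ordered_graph n).

Definition dominate_adj : rel 'I_(n + a) := fun x y =>
  match split x, split y with
  | inl i, inl j => G i j
  | _, _ => x != y
  end.

Lemma dominate_sym : symmetric dominate_adj.
Proof.
move=> x y; rewrite /dominate_adj; case: (split x) => i; case: (split y) => j;
  by rewrite ?(eq_sym x) // adj_sym.
Qed.

Lemma dominate_irr : irreflexive dominate_adj.
Proof.
by move=> x; rewrite /dominate_adj; case: (split x) => i; rewrite ?adj_irr ?eqxx.
Qed.

Definition dominate : ordered_graph (n + a) := SGraph dominate_sym dominate_irr.

Lemma split_lshift (i : 'I_n) : split (lshift a i) = inl i.
Proof. exact: (unsplitK (inl i)). Qed.

Lemma degree_dominate_lshift (i : 'I_n) :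
  (degree G i + a <= degree dominate (lshift a i))%N.
Proof.
have aE : #|@rshift n a @: [set: 'I_a]| = a.
  by rewrite card_imset; [rewrite cardsT card_ord|apply: rshift_inj].
rewrite -[X in (_ + X)%N]aE /degree -(card_imset _ (@lshift_inj n a)).
rewrite -cardsUI (_ : _ :&: _ = set0) ?cards0 ?addn0.
  apply: subset_leq_card; apply/subsetP => x.
  rewrite !inE => /orP[/imsetP[j + ->]|/imsetP[j _ ->]].
    by rewrite inE /= /dominate_adj !split_lshift.
  rewrite /= /dominate_adj split_lshift (unsplitK (inr j)) -val_eqE /=.
  by rewrite neq_ltn (leq_trans (ltn_ord i)) ?leq_addr.
apply/setP => x; rewrite !inE; apply/negP => /andP[/imsetP[j _ ->] /imsetP[l _ /eqP]].
by rewrite eq_lrshift.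
Qed.

Lemma degree_dominate_rshift (i : 'I_a) :
  ((n + a).-1 <= degree dominate (rshift n i))%N.
Proof.
have := cardC1 (rshift n i); rewrite card_ord => <-.
apply: subset_leq_card; apply/subsetP => x; rewrite !inE /= /dominate_adj.
by rewrite (unsplitK (inr i)) eq_sym; case: (split x).
Qed.

(** Only copies inside [G] are kept. Each new vertex lies in at most one discarded copy, which
    uncovers at most [h] old vertices. *)
Lemma tiling_of_dominate (h : nat) (H : ordered_graph h)
    (T : {set {ffun 'I_h -> 'I_(n + a)}}) :
  is_tiling H dominate T ->
  exists T', is_tiling H G T' /\ (#|~: covered T'| <= #|~: covered T| + a * h)%N.
Proof.
move=> [eT dT].
pose up (g : {ffun 'I_h -> 'I_n}) : {ffun 'I_h -> 'I_(n + a)} :=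
  [ffun i => lshift a (g i)].
have upinj : injective up.
  move=> g g' /ffunP e; apply/ffunP => i; have := e i; rewrite !ffunE.
  exact: lshift_inj.
exists [set g | up g \in T]; split; first split.
- move=> g; rewrite inE => /eT[ginj gmono gadj]; split=> [i j e|i j|i j].
  + by apply: ginj; rewrite !ffunE e.
  + by move/gmono; rewrite !ffunE.
  + by move/gadj; rewrite !ffunE /= /dominate_adj !split_lshift.
- move=> g g'; rewrite !inE => gT g'T ngg'.
  have nup : up g != up g' by rewrite (inj_eq upinj).
  have := dT _ _ gT g'T nup; rewrite !disjoint_subset => /subsetP dg.
  apply/subsetP => _ /codomP[i ->]; rewrite inE; apply/codomP => -[j e].
  have := dg (up g i) (codom_f _ _); rewrite inE => /negP; apply.
  by apply/codomP; exists j; rewrite !ffunE e.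
pose S (w : 'I_a) : {set 'I_n} :=
  if [pick f in T | rshift n w \in codom f] is Some f
  then [set v | lshift a v \in codom f] else set0.
have cS w : (#|S w| <= h)%N.
  rewrite /S; case: pickP => [f _|_]; last by rewrite cards0.
  rewrite -(card_imset _ (@lshift_inj n a)) -[leqRHS]card_ord.
  apply: leq_trans (leq_image_card f predT); apply: subset_leq_card.
  by apply/subsetP => _ /imsetP[v + ->]; rewrite inE.
have sub : ~: covered [set g | up g \in T] \subset
    [set v | lshift a v \in ~: covered T] :|: \bigcup_w S w.
  apply/subsetP => v; rewrite !inE => nv.
  have [/bigcupP[f fT]|//] := boolP (lshift a v \in covered T).
  rewrite inE /= => vf; apply/bigcupP.
  have [w wf] : exists w, rshift n w \in codom f.
    apply/existsP; apply: contraNT nv; rewrite negb_exists => /forallP noR.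
    have /fin_all_exists[g gP] i : exists j, f i = lshift a j.
      case: (splitP (f i)) => [j e|j e]; first by exists j; apply: val_inj.
      have := noR j; rewrite (_ : rshift n j = f i) ?codom_f //.
      by apply: val_inj; rewrite /= e.
    have ef : up (finfun g) = f by apply/ffunP => i; rewrite !ffunE gP.
    apply/bigcupP; exists (finfun g); first by rewrite inE ef.
    move: vf; rewrite inE -ef => /codomP[i]; rewrite ffunE => /lshift_inj ->.
    exact: codom_f.
  exists w => //; rewrite /S; case: pickP => [f' /andP[f'T wf']|/(_ f)].
    have [->|nff'] := eqVneq f' f; first by rewrite inE.
    have := dT _ _ f'T fT nff'; rewrite disjoint_subset => /subsetP/(_ _ wf').
    by rewrite inE => /negP[].
  by rewrite /= fT wf.
apply: leq_trans (subset_leq_card sub) _; apply: leq_trans (leq_card_setU _ _) _.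
apply: leq_add.
  rewrite -(card_imset _ (@lshift_inj n a)); apply: subset_leq_card.
  by apply/subsetP => _ /imsetP[v + ->]; rewrite inE.
apply: (@leq_trans (\sum_(w < a) #|S w|)).
  elim/big_rec2: _ => [|w k B _ IH]; first by rewrite cards0.
  by apply: leq_trans (leq_card_setU _ _) _; rewrite leq_add2l.
rewrite -[X in (_ <= X * h)%N]card_ord -sum_nat_const.
exact: leq_sum.
Qed.

End Dominate.

Lemma forces_closed (R : realType) (h : nat) (H : ordered_graph h) (c : R) :
  0 <= c -> c < 1 ->
  (forall c', c < c' -> c' < 1 -> forces_almost_tiling H c') ->
  forces_almost_tiling H c.
Proof.
move=> c0 c1 forceH eta eta0.
have [eps [e0 e1 eh]] : exists eps : R,
    [/\ 0 < eps, eps <= 1 & 4 * eps * h%:R <= eta].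
  have h0 : 0 < 4 * (h%:R + 1) :> R by rewrite mulr_gt0 // ltr_wpDl.
  exists (Num.min 1 (eta / (4 * (h%:R + 1)))).
  rewrite lt_min ltr01 ge_min lexx divr_gt0 //; split=> //.
  have : Num.min 1 (eta / (4 * (h%:R + 1))) <= eta / (4 * (h%:R + 1)).
    by rewrite ge_min lexx orbT.
  rewrite ler_pdivlMr //; set e := Num.min _ _ => le1.
  have : 0 <= e by rewrite /e le_min ler01 divr_ge0 // ltW.
  lra.
(* About [eps * n] dominating vertices raise the degree ratio from [c] by at least [th]. The
   uncovered vertices split into [eta / 2 * n] from the tiling and [eta / 2 * n] from discarded
   copies. *)
pose th := eps * (1 - c) / 4.
have th0 : 0 < th by rewrite divr_gt0 // mulr_gt0 // subr_gt0.
have th1 : th <= (1 - c) / 4.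
  by rewrite ler_pM2r ?invr_gt0 // -[leRHS]mul1r ler_pM2r // subr_gt0.
have gt_c : c < c + th by lra.
have lt_1 : c + th < 1 by lra.
have [|N1 N1P] := forceH _ gt_c lt_1 (eta / 6); first by lra.
have [N2 N2P] := exists_natr_gt eps^-1.
have [N3 N3P] := exists_natr_gt (2 / (1 - c)).
exists (maxn N1 (maxn N2 N3)) => n G; rewrite !geq_max => /and3P[leN1 leN2 leN3] degG.
have en : 1 <= eps * n%:R.
  move: N2P; rewrite -div1r ltr_pdivrMr // => /ltW/le_trans; apply.
  by rewrite mulrC ler_pM2l // ler_nat.
have cn : 2 <= (1 - c) * n%:R.
  have c1' : 0 < 1 - c by rewrite subr_gt0.
  move: N3P; rewrite ltr_pdivrMr // => /ltW/le_trans; apply.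
  by rewrite mulrC ler_pM2l // ler_nat.
have en0 : 0 <= eps * n%:R by apply: le_trans en.
have [a [agt ale]] : exists a : nat, eps * n%:R < a%:R /\ a%:R <= 2 * eps * n%:R.
  exists (Num.truncn (eps * n%:R)).+1; rewrite truncnS_gt; split=> //.
  have : (Num.truncn (eps * n%:R))%:R <= eps * n%:R by rewrite truncn_le.
  rewrite -natr1; lra.
have n0 : 0 <= n%:R :> R by [].
have an : a%:R <= 2 * n%:R :> R.
  apply: le_trans ale _; rewrite -mulrA ler_pM2l // -[leRHS]mul1r.
  by rewrite ler_wpM2r.
have thn : th * (n%:R + a%:R) <= th * (3 * n%:R).
  by apply: ler_wpM2l; [exact: ltW|lra].
have tha : th * (3 * n%:R) <= 3 / 4 * ((1 - c) * a%:R).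
  have : (1 - c) * (eps * n%:R) <= (1 - c) * a%:R
    by apply: ler_wpM2l; rewrite ?subr_ge0 ltW.
  rewrite /th; lra.
have ca : 0 <= (1 - c) * a%:R by rewrite mulr_ge0 // subr_ge0 ltW.
have [||T [tT cT]] := N1P (n + a)%N (dominate a G).
- by rewrite (leq_trans leN1) // leq_addr.
- rewrite natrD; apply: le_mindegree => [|x].
    by rewrite card_ord natrD; lra.
  rewrite -(splitK x); case: (split x) => i /=.
    apply: (@le_trans _ _ (degree G i + a)%:R); last first.
      by rewrite ler_nat degree_dominate_lshift.
    have : c * n%:R <= (degree G i)%:R.
      by apply: le_trans degG _; rewrite ler_nat mindegree_le.
    rewrite natrD; lra.
  apply: (@le_trans _ _ (n + a).-1%:R); last by rewrite ler_nat degree_dominate_rshift.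
  have : (n + a).-1%:R + 1 = n%:R + a%:R :> R.
    have na0 : (0 < n + a)%N by rewrite addn_gt0 (leq_ltn_trans _ (ltn_ord i)) ?orbT.
    by rewrite natr1 -natrD prednK.
  lra.
have [T' [tT' cT']] := tiling_of_dominate tT.
exists T'; split=> //; apply: (@le_trans _ _ (#|~: covered T| + a * h)%:R).
  by rewrite ler_nat.
rewrite natrD natrM; have : a%:R * h%:R <= 2 * eps * n%:R * h%:R by rewrite ler_wpM2r.
have : 4 * eps * h%:R * n%:R <= eta * n%:R by rewrite ler_wpM2r.
have : eta * (n%:R + a%:R) <= eta * (3 * n%:R).
  by apply: ler_wpM2l; [exact: ltW|lra].
move: cT; rewrite natrD; lra.
Qed.

Theorem theorem12p1 (R : realType) (h : nat) (H : ordered_graph h) :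
  is_c_lt H (1 - 1 / chi_cr_star R H).
Proof.
pose S := [set r : R | exists (b : nat) (B : sgraph 'I_b),
    [/\ is_bottlegraph H B, (1 < chi B)%N & r = chi_cr R B]]%classic.
have [[x0 Sx0]|noS] := boolp.pselect (exists x, S x); last first.
  (* Without bottlegraphs, as for [h = 0], the infimum and its inverse are 0 by convention, so the
     claim is that the threshold is 1. No nonempty graph has minimum degree [n], and a smaller
     threshold would give a bottlegraph. *)
  have -> : chi_cr_star R H = 0.
    rewrite /chi_cr_star -/S inf_out //; move=> [[x Sx] _].
    by apply: noS; exists x.
  rewrite invr0 mulr0 subr0; split=> // [eta _|c' c'0 forceH].
    exists 1%N => n G n0; rewrite mul1r ler_nat leqNgt => /negP[].
    apply: leq_ltn_trans (mindegree_le G (Ordinal n0)) _.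
    rewrite -[ltnRHS]card_ord; apply: proper_card; apply/properP; split.
      by apply/subsetP => x.
    by exists (Ordinal n0); rewrite ?inE ?adj_irr.
  rewrite leNgt; apply/negP => c'1; apply: noS.
  have [b [B [bB kB _]]] := bottlegraph_of_forces c'0 c'1 forceH (@ltr01 R).
  by exists (chi_cr R B), b, B.
have S1 : lbound S 1.
  move=> _ [b [B [bB kB ->]]]; apply/ler_addgt0Pr => e e0.
  have [r [m [s [r0 sm le _]]]] := bottlegraph_bottle bB kB e0.
  have m0 : 0 < m%:R :> R by rewrite ltr0n (leq_ltn_trans _ sm).
  rewrite -(ler_pM2r m0) mul1r (le_trans _ le) // ler_nat.
  by rewrite (leq_trans _ (leq_addr _ _)) // leq_pmull.
have Sn0 : (S !=set0)%classic by exists x0.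
pose X := chi_cr_star R H.
have X1 : 1 <= X by apply: lb_le_inf.
have X0 : 0 < X by apply: lt_le_trans X1.
rewrite -/X div1r; have iX0 : 0 < X^-1 by rewrite invr_gt0.
have iX1 : X^-1 <= 1 by rewrite invf_le1.
split; first by rewrite subr_ge0.
- apply: forces_closed => [||c' cc' c'1]; [by rewrite subr_ge0|lra|].
  have c1 : 0 < 1 - c' by lra.
  (* Since [c' > 1 - 1 / X], some bottlegraph has critical chromatic number below [1 / (1 - c')];
     half of the gap is the error allowed in passing to tiles. *)
  have ltX : X < (1 - c')^-1.
    by rewrite -[X]invrK ltf_pV2 ?posrE //; lra.
  have [_ [b [B [bB kB ->]]] ltB] := inf_lt Sn0 ltX.
  have e0 : 0 < ((1 - c')^-1 - chi_cr R B) / 2 by rewrite divr_gt0 // subr_gt0.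
  have [r [m [s [r0 sm le tms]]]] := bottlegraph_bottle bB kB e0.
  have m0 : 0 < m%:R :> R by rewrite ltr0n (leq_ltn_trans _ sm).
  have b0 : 0 < (r * m + s)%:R :> R.
    by rewrite ltr0n addn_gt0 muln_gt0 r0 (leq_ltn_trans _ sm).
  apply: (forces_of_bottle (d := (r.-1 * m + s)%:R / (r * m + s)%:R) r0 sm tms).
    by rewrite divfK // gt_eqF.
  rewrite ltr_pdivrMr //.
  have lt : (1 - c') * (r * m + s)%:R < m%:R.
    rewrite mulrC -ltr_pdivlMr // [_ / _]mulrC; apply: le_lt_trans le _.
    by rewrite ltr_pM2r //; lra.
  have -> : (r.-1 * m + s)%:R = (r * m + s)%:R - m%:R :> R.
    have e : (r * m + s = r.-1 * m + s + m)%N by rewrite addnAC -mulSnr prednK.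
    by rewrite [in RHS]e [X in _ = X - _]natrD addrK.
  lra.
- move=> c' c'0 forceH; have [c'1|c'1] := leP 1 c'; first by lra.
  rewrite leNgt; apply/negP => lt.
  (* With half the gap as error, the resulting bottlegraph has critical chromatic number at most the
     inverse of [X^-1 + (1 - X^-1 - c') / 2], which is below the infimum [X]. *)
  have e0 : 0 < (1 - X^-1 - c') / 2 by lra.
  have [b [B [bB kB le]]] := bottlegraph_of_forces c'0 c'1 forceH e0.
  have XB : X <= chi_cr R B.
    apply: ge_inf; first by exists 1.
    by exists b, B.
  have B0 : 0 < chi_cr R B by apply: lt_le_trans XB.
  have h1 : 1 <= chi_cr R B * X^-1.
    by rewrite -[leLHS](mulfV (lt0r_neq0 X0)) ler_pM2r.
  have h2 : 0 < chi_cr R B * ((1 - X^-1 - c') / 2) by rewrite mulr_gt0.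
  have e : 1 - c' - (1 - X^-1 - c') / 2 = X^-1 + (1 - X^-1 - c') / 2 by lra.
  move: le; rewrite e mulrDr; lra.
Qed.
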